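(* There is a constant $c$ such that for infinitely many integers $n$, there is a $2$-degenerate graph $G$ that has a path of order $n$ and no induced path of order more than $c \cdot \log \log n \cdot \log \log \log n$.
   Context: A graph is $k$-degenerate if every subgraph of it has a vertex of degree at most $k$. The order of a path is its number of vertices. All logarithms are binary. *)

(* Defs.v *)
From mathcomp Require Import all_boot all_order all_algebra.
From mathcomp Require Import reals exp.

Set Implicit Arguments.
Unset Strict Implicit.
Unset Printing Implicit Defensive.

Import Order.TTheory GRing.Theory Num.Theory.

Record sgraph : Type := SGraph {
  vertex :> finType;
  adj : rel vertex;
  adj_sym : symmetric adj;
  adj_irr : irreflexive adj }.

Record subgraph (G : sgraph) : Type := Subgraph {
  sub_vertex : {set G};
  sub_adj : rel G;
  sub_adj_sym : symmetric sub_adj;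
  sub_adjP : forall x y, sub_adj x y ->
    [/\ adj x y, x \in sub_vertex & y \in sub_vertex] }.

Definition sub_degree (G : sgraph) (H : subgraph G) (x : G) : nat :=
  #|[pred y | sub_adj H x y]|.

(* Subgraphs are taken to be non-null: the graph without vertices trivially has
   no vertex of degree at most k. *)
Definition degenerate (k : nat) (G : sgraph) : Prop :=
  forall H : subgraph G, (exists x, x \in sub_vertex H) ->
    exists2 x, x \in sub_vertex H & sub_degree H x <= k.

(* A path is given by the sequence of its vertices; its order is the size of
   this sequence. *)
Definition is_path (G : sgraph) (p : seq G) : Prop :=
  uniq p /\ sorted (@adj G) p.

Definition is_induced_path (G : sgraph) (p : seq G) : Prop :=
  is_path p /\
  forall x y, x \in p -> y \in p -> adj x y ->
    index y p = (index x p).+1 \/ index x p = (index y p).+1.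

(* ln is 0 outside of the positive reals, hence so is log2. *)
Definition log2 {R : realType} (x : R) : R := (ln x / ln 2)%R.

(* Main.v *)
Require Import Defs.
From mathcomp Require Import all_boot all_order all_algebra.
From mathcomp Require Import classical_sets cardinality reals.
From mathcomp Require Import exp zify.

(* A unit is a path of valleys in which any two consecutive valleys are also
   joined by a mountain: two legs made of slots, carrying labels below
   lam = 2^(N+1), whose tops are two adjacent gates labelled 2j and 2j+1.
   G_0 is a unit; G_(m+1) attaches to every unit of G_m a private copy of G_m,
   whose slots labelled 2m and 2m+1 are joined to the gate of the same label.
   - A path crossing a unit can make a detour through the attached copy between
     its two gates of level m, so the number of vertices of a path is squared at
     every level: after 2^N levels there is a path of order 2^2^(2^N-1).
   - Ordering the units by depth and each unit from the valleys upwards leaves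
     every vertex with at most two earlier neighbours.
   - The two gates being adjacent, an induced path that enters an attached copy
     never comes back. Hence it consists of a core inside one unit, continued on
     either side by a chain of descents through gates of increasing level.
     After entering a copy at a slot labelled e, it must avoid all other
     e-slots, which are joined to the gate it came from. As labels change by at
     most one along an edge of a unit, it either stays at labels at least e, and
     then the links of a chain lie in successive zones of a leg and their
     lengths telescope, or it stays below e. In the latter case let c = e and
     let c' < c be the label of the last descent: every label c occurs on every
     leg at about the distance c - c' below c, which confines the path, up to
     that descent, to a zone of size O(N (c - c')). Induction on c bounds the
     whole path by O(N 2^N). *)

Set Implicit Arguments.
Unset Strict Implicit.
Unset Printing Implicit Defensive.

Import Order.TTheory GRing.Theory Num.Theory.

(** * Induced paths and connectivity along paths *)

Section InducedPaths.
Variables (T : eqType) (e : rel T).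

Definition chordless (s : seq T) :=
  forall s1 x s2 y s3, s = s1 ++ x :: s2 ++ y :: s3 -> e x y -> s2 = [::].

Definition ipath (s : seq T) := [/\ uniq s, sorted e s & chordless s].

Lemma sorted_infix s1 s2 s3 : sorted e (s1 ++ s2 ++ s3) -> sorted e s2.
Proof.
by move=> h; apply: (@infix_sorted _ e s2 _ _ h); apply/infixP; exists s1, s3.
Qed.

Lemma ipath_infix s1 s2 s3 : ipath (s1 ++ s2 ++ s3) -> ipath s2.
Proof.
case=> u so ch; split.
- by move: u; rewrite !cat_uniq => /and3P[_ _ /and3P[]].
- exact: sorted_infix so.
- move=> t1 x t2 y t3 E exy; apply: (ch (s1 ++ t1) x t2 y (t3 ++ s3)) => //.
  by rewrite E -!catA /= -!catA.
Qed.

Lemma ipath_cat s1 s2 : ipath (s1 ++ s2) -> ipath s1 /\ ipath s2.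
Proof.
move=> h; split; first exact: (@ipath_infix [::] s1 s2).
by apply: (@ipath_infix s1 s2 [::]); rewrite cats0.
Qed.

Lemma ipath_rev s : symmetric e -> ipath s -> ipath (rev s).
Proof.
move=> sy [u so ch]; split; first by rewrite rev_uniq.
- rewrite rev_sorted; apply: sub_sorted so => x y; by rewrite sy.
- move=> s1 x s2 y s3 /(congr1 rev); rewrite revK !(rev_cat, rev_cons) => E exy.
  have /(congr1 rev) : rev s2 = [::].
    apply: (ch (rev s3) y (rev s2) x (rev s1)); last by rewrite sy.
    by rewrite E -!cats1 -?catA /= -?catA.
  by rewrite revK.
Qed.

(** The connectivity tool of the development: whatever adjacent vertices must share (a mountain, a
    copy, a side of a label) is shared by the whole path. *)
Lemma sorted_const (C : Type) (f : T -> C) s :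
  {in s &, forall y z, e y z -> f y = f z} -> sorted e s ->
  {in s &, forall y z, f y = f z}.
Proof.
case: s => // x s H so.
suff K : {in x :: s, forall y, f y = f x} by move=> y z /K-> /K->.
elim: s x H so => [|y s IH] x H /=; first by move=> _ z; rewrite inE => /eqP->.
case/andP=> exy so z; rewrite inE => /orP[/eqP->//|zs].
rewrite (IH y) //; first by rewrite (H x y) ?inE ?eqxx ?orbT.
by move=> a b ha hb; apply: H; rewrite inE ?ha ?hb orbT.
Qed.

Lemma prefix_split (P : pred T) s : exists a b,
  [/\ s = a ++ b, all P a & forall x b', b = x :: b' -> ~~ P x].
Proof.
elim: s => [|x s [a [b [-> Pa Hb]]]]; first by exists [::], [::].
case Px: (P x); first by exists (x :: a), b; rewrite /= Px.
by exists [::], (x :: a ++ b); split=> // y b' [<- _]; rewrite Px.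
Qed.

(* A segment of an induced path inside a cell that leaves it at both ends
   would be cut short by the edge joining its two outer neighbours. *)
Lemma ipath_cells (C : eqType) (O : pred T) (cell : T -> C) s :
  {in predC O &, forall x y, e x y -> cell x = cell y} ->
  (forall x y a b, O x -> O y -> x != y -> ~~ O a -> ~~ O b ->
     e x a -> e b y -> cell a = cell b -> e x y) ->
  ipath s -> exists t1 Q t2,
  [/\ s = t1 ++ Q ++ t2, all O Q, all (predC O) t1, all (predC O) t2
    & Q = [::] -> t2 = [::]].
Proof.
move=> H1 H2 [us so ch].
have [t1 [b [E t1O Hb]]] := prefix_split (predC O) s.
case: b E Hb => [|o b'] E Hb; first by exists t1, [::], [::].
have Oo : O o by have := Hb _ _ erefl; rewrite /= negbK.
have [Q [t2 [E2 QO Ht2]]] := prefix_split O (o :: b').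
case: Q E2 QO => [|o' Q] E2 QO; first by have := Ht2 _ _ (esym E2); rewrite Oo.
exists t1, (o' :: Q), t2; split; rewrite // -?E2 //.
have [I [t3 [E3 IO Ht3]]] := prefix_split (predC O) t2.
case: t3 E3 Ht3 => [|o2 Y] E3 Ht3; first by rewrite E3 cats0.
have Oo2 : O o2 by have := Ht3 _ _ erefl; rewrite /= negbK.
case: I E3 IO => [|i I] E3 IO; first by have := Ht2 _ _ E3; rewrite Oo2.
move: QO E2; rewrite lastI all_rcons; set o1 := last _ _; case/andP=> Oo1 _ E2.
have Es : s = (t1 ++ belast o' Q) ++ o1 :: (i :: I) ++ o2 :: Y.
  by rewrite E E2 E3 cat_rcons -catA.
have := ch _ _ _ _ _ Es; suff eo : e o1 o2 by move/(_ eo).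
have /andP[e1 soI] : e o1 i && path e i (I ++ o2 :: Y).
  have := @sorted_infix (t1 ++ belast o' Q) (o1 :: (i :: I) ++ o2 :: Y) [::].
  by rewrite cats0 -Es => /(_ so).
have /andP[pI e2] : path e i I && e (last i I) o2.
  by move: soI; rewrite cat_path /= => /and3P[-> ->].
apply: (H2 _ _ i (last i I)) => //.
- move: us; rewrite Es cat_uniq => /and3P[_ _] /= /andP[n _].
  by apply: contraNneq n => ->; rewrite !(inE, mem_cat) eqxx !orbT.
- by move/allP: IO => /(_ i); rewrite inE eqxx => /(_ isT).
- by move/allP: IO => /(_ (last i I)); rewrite mem_last => /(_ isT).
- apply: (@sorted_const _ cell (i :: I)) => //; rewrite ?mem_last ?inE ?eqxx //.
  by move=> y z /(allP IO) hy /(allP IO) hz; apply: H1.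
Qed.

End InducedPaths.

Lemma ipath_map (T T' : eqType) (e : rel T) (e' : rel T') (f : T -> T') s :
  (forall x y, e' (f x) (f y) = e x y) -> ipath e' (map f s) -> ipath e s.
Proof.
move=> H [u so ch]; split; first exact: map_uniq u.
- by move: so; rewrite sorted_map; apply: sub_sorted => x y /=; rewrite H.
- move=> s1 x s2 y s3 E exy; apply/eqP; rewrite -size_eq0 -(size_map f).
  have -> // : map f s2 = [::].
  apply: (ch (map f s1) (f x) _ (f y) (map f s3)); last by rewrite H.
  by rewrite E map_cat map_cons map_cat map_cons.
Qed.

Definition nat_step (x y : nat) := (y == x.+1) || (x == y.+1).

Lemma nat_stepC : symmetric nat_step.
Proof. by move=> x y; rewrite /nat_step orbC. Qed.

(** Discrete intermediate value: a step of one cannot change the truth of [_ < z] without touching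
    [z]. *)
Lemma nat_step_cover s x y z :
  sorted nat_step s -> x \in s -> y \in s -> x <= z <= y -> z \in s.
Proof.
move=> so xs ys /andP[xz zy]; apply/negPn/negP => zs.
have /(_ x y xs ys) : {in s &, forall y y', (y < z) = (y' < z)}.
  apply: (@sorted_const _ nat_step _ (fun y => y < z)) so => a b ha hb; rewrite /nat_step.
  have az : a != z by apply: contraNneq zs => <-.
  have bz : b != z by apply: contraNneq zs => <-.
  by move=> /orP[] /eqP E; move: az bz; rewrite E; case: ltngtP; case: ltngtP => //; lia.
rewrite (ltnNge y) zy /= => xz'; move: xs; have -> // : x = z by lia.
by rewrite (negPf zs).
Qed.

(** * The labels along a leg *)

Section Labels.
Variable N : nat.

Definition nlev := 2 ^ N.
Definition lam := nlev.*2.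

(* The labels along a leg: block y climbs from y up to about y + 4 gcd(y, lam)
   and returns to y. A label is thus met at every scale below itself
   ([label_hit]), although the blocks have average length O(N). *)
Definition hgt y := minn (4 * gcdn y lam).+1 (lam - y).

(** Block 0 has no rise: it starts at [lam - 1], just below the value [lam] given to valleys, and
    falls through every label. *)
Definition exc y :=
  (if y == 0 then [::] else iota y (hgt y)) ++ rev (iota y (hgt y)).

Definition theta n := flatten [seq exc y | y <- iota 0 n].

(** The height at which block [y] starts. All legs are prefixes of one sequence, so it does not
    depend on the mountain. *)
Definition st y := size (theta y).

Definition lab i := nth 0 (theta lam) i.

Definition lip (a b : nat) := (a <= b.+1) && (b <= a.+1).

Lemma nlev_gt0 : 0 < nlev. Proof. by rewrite expn_gt0. Qed.

Lemma lam_gt1 : 1 < lam. Proof. by rewrite /lam; have := nlev_gt0; lia. Qed.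

Lemma hgt_gt0 y : y < lam -> 0 < hgt y.
Proof. by move=> h; rewrite leq_min subn_gt0 h. Qed.

Lemma hgt0 : hgt 0 = lam.
Proof. by rewrite /hgt gcd0n subn0; apply/minn_idPr; lia. Qed.

Lemma theta_S n : theta n.+1 = theta n ++ exc n.
Proof. by rewrite /theta -addn1 iotaD map_cat flatten_cat /= cats0. Qed.

Lemma st_S y : st y.+1 = st y + size (exc y).
Proof. by rewrite /st theta_S size_cat. Qed.

Lemma st_mono a b : a <= b -> st a <= st b.
Proof.
elim: b => [|b IH]; first by rewrite leqn0 => /eqP->.
by rewrite leq_eqVlt => /orP[/eqP->//|/IH]; rewrite st_S; lia.
Qed.

Lemma exc_mem y l : (l \in exc y) = (y <= l < y + hgt y).
Proof. by rewrite /exc mem_cat mem_rev; case: eqP; rewrite ?mem_iota ?orbb. Qed.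

Lemma exc_gt0 y : y < lam -> 0 < size (exc y).
Proof. by move=> h; rewrite size_cat size_rev size_iota; have := hgt_gt0 h; lia. Qed.

Lemma theta_cat a b : a <= b -> exists s, theta b = theta a ++ s.
Proof.
elim: b => [|b IH]; first by rewrite leqn0 => /eqP->; exists [::]; rewrite cats0.
rewrite leq_eqVlt => /orP[/eqP->|/IH[s E]]; first by exists [::]; rewrite cats0.
by exists (s ++ exc b); rewrite theta_S E catA.
Qed.

Lemma lab_block y i : y < lam -> i < size (exc y) ->
  lab (st y + i) = nth 0 (exc y) i.
Proof.
move=> yl il; have [s E] := theta_cat yl.
rewrite /lab E nth_cat -/(st _) st_S ltn_add2l il theta_S nth_cat.
by rewrite ltnNge leq_addr /= addKn.
Qed.

Lemma block_of n i : i < st n -> exists2 y, y < n & st y <= i < st y.+1.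
Proof.
elim: n => // n IH; case: (ltnP i (st n)) => [/IH[y yn h] _|h1 h2].
  by exists y => //; apply: ltnW.
by exists n; rewrite ?h1.
Qed.

Lemma lab_mem y i : y < lam -> st y <= i < st y.+1 -> lab i \in exc y.
Proof.
move=> yl; rewrite st_S => /andP[h1 h2]; have hi : i - st y < size (exc y) by lia.
by rewrite -(subnKC h1) lab_block //; apply: mem_nth.
Qed.

Lemma exc_at y l : y < lam -> l \in exc y ->
  exists2 i, st y <= i < st y.+1 & lab i = l.
Proof.
move=> yl ly; exists (st y + index l (exc y)).
  by rewrite leq_addr st_S ltn_add2l index_mem.
by rewrite lab_block ?index_mem // nth_index.
Qed.

Lemma lab_ge y i : st y <= i -> i < st lam -> y <= lab i.
Proof.
move=> h /block_of[x xl hx]; have := lab_mem xl hx; rewrite exc_mem => /andP[h1 _].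
apply: leq_trans h1; rewrite leqNgt; apply/negP => xy.
by case/andP: hx => _ /leq_trans /(_ (st_mono xy)); rewrite ltnNge h.
Qed.

(** The fall of block [y] ends at [y]. This slot is the barrier that a path avoiding label [y]
    cannot cross on a leg. *)
Lemma lab_last y : y < lam -> lab (st y.+1).-1 = y.
Proof.
move=> yl; have h := hgt_gt0 yl; have g := exc_gt0 yl.
have -> : (st y.+1).-1 = st y + (size (exc y)).-1 by rewrite st_S; lia.
rewrite lab_block //; last by lia.
rewrite nth_last /exc; case: (hgt y) h => // n _.
by rewrite [iota y n.+1]/= rev_cons last_cat last_rcons.
Qed.

Lemma path_iota x y n : lip x y -> path lip x (iota y n).
Proof.
elim: n x y => // n IH x y h; rewrite /= h IH //.
by rewrite /lip; lia.
Qed.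

Lemma path_rev_iota x y n : lip x (y + n).-1 -> path lip x (rev (iota y n)).
Proof.
elim: n x => // n IH x h.
rewrite -addn1 iotaD rev_cat /= IH.
  by move: h; rewrite /lip; lia.
by rewrite /lip; lia.
Qed.

Lemma last_iota x y n : 0 < n -> last x (iota y n) = (y + n).-1.
Proof.
by case: n => // n _; rewrite -addn1 iotaD last_cat /=; lia.
Qed.

Lemma last_rev_iota x y n : 0 < n -> last x (rev (iota y n)) = y.
Proof. by case: n => // n _; rewrite [iota y n.+1]/= rev_cons last_rcons. Qed.

Lemma path_exc x y : y < lam -> lip x (if y == 0 then lam.-1 else y) ->
  path lip x (exc y) /\ last x (exc y) = y.
Proof.
move=> yl; have h := hgt_gt0 yl; rewrite /exc; case: eqP => [->|_] hx.
  rewrite cat0s hgt0; split; last exact/last_rev_iota/ltnW/lam_gt1.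
  by apply: path_rev_iota; move: hx; rewrite /lip; lia.
rewrite cat_path last_cat path_iota // last_iota // last_rev_iota //; split=> //=.
by apply: path_rev_iota; rewrite /lip; lia.
Qed.

Lemma path_theta n : n <= lam -> path lip lam (theta n) /\
  last lam (theta n) = (if n == 0 then lam else n.-1).
Proof.
elim: n => // n IH nl; have [p l] := IH (ltnW nl).
have := @path_exc (if n == 0 then lam else n.-1) n nl.
rewrite theta_S cat_path last_cat l p => -[|-> ->] //.
by case: n {IH nl p l} => [|n] /=; rewrite /lip; lia.
Qed.

Lemma lab_lip i : i.+1 < st lam -> lip (lab i) (lab i.+1).
Proof.
move=> h; have [p _] := path_theta (leqnn lam).
by have /(pathP 0) /(_ i.+1 h) := p.
Qed.

Lemma st1 : st 1 = lam.
Proof. by rewrite st_S /st /= add0n /exc /= size_rev size_iota hgt0. Qed.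

Lemma lab_first i : i < lam -> lab i = lam - i.+1.
Proof.
have l0 : 0 < lam by apply/ltnW/lam_gt1.
have E : exc 0 = rev (iota 0 lam) by rewrite /exc /= hgt0.
move=> h; have := @lab_block 0 i l0; rewrite E add0n => -> ; last first.
  by rewrite size_rev size_iota.
by rewrite nth_rev size_iota // nth_iota //; lia.
Qed.

(** The room that block [y] offers, on one leg, to a path with labels below [c]. *)
Definition nbelow c y := count (fun l => l < c) (exc y).

Lemma count_iota_lt c y n : count (fun l => l < c) (iota y n) <= minn n (c - y).
Proof. by elim: n y => //= n IH y; have := IH y.+1; case: (ltnP y c); lia. Qed.

Lemma nbelow_le c y : nbelow c y <= (minn (hgt y) (c - y)).*2.
Proof.
rewrite /nbelow /exc count_cat count_rev.
have h := count_iota_lt c y (hgt y).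
by case: eqP => _ /=; lia.
Qed.

Lemma count_lab c a b : a <= b <= lam ->
  count (fun i => lab i < c) (iota (st a) (st b - st a))
  = \sum_(a <= y < b) nbelow c y.
Proof.
case/andP=> ab; elim: b ab => [|b IH].
  by rewrite leqn0 => /eqP->; rewrite subnn big_geq.
rewrite leq_eqVlt => /orP[/eqP<- _|]; first by rewrite subnn big_geq.
rewrite ltnS => ab bl; rewrite big_nat_recr //= -IH //; last exact: ltnW.
have := st_mono ab => h; rewrite st_S -addnBAC // iotaD count_cat; congr (_ + _).
rewrite subnKC // /nbelow -(count_map lab (fun l => l < c)); congr count.
apply: (@eq_from_nth _ 0); rewrite size_map size_iota // => i hi.
by rewrite (nth_map 0) ?size_iota // nth_iota // lab_block.
Qed.

End Labels.

(** * The unit: slots, gates and values *)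

Section Unit.
Variable N : nat.
Local Notation nlev := (nlev N).
Local Notation lam := (lam N).
Local Notation st := (st N).
Local Notation lab := (lab N).
Local Notation exc := (exc N).
Local Notation nbelow := (nbelow N).

(** Mountain [j] carries the blocks 0 to [2j+1], so its last slots carry the larger of its two gate
    labels. *)
Definition len j := st j.*2.+2.
Definition maxlen := (st lam).+1.

(* [inl v] is a valley; [inr (j, b, i)] is the vertex at height i of the leg b of
   mountain j, which rises from the valley j + b. It is a slot if i < len j and a
   gate if i = len j; the vertices with i > len j are isolated padding. *)
Definition pos : finType := ('I_nlev.+1 + 'I_nlev * bool * 'I_maxlen)%type.

Definition isslot e (p : pos) :=
  if p is inr (j, _, i) then (i < len j) && (lab i == e) else false.

Definition isgate e (p : pos) :=
  if p is inr (j, b, i) then (i == len j :> nat) && (e == j.*2 + b) else false.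

(* Extends the labels of the slots to all vertices so that they change by at most
   one along every edge. *)
Definition mu (p : pos) :=
  if p is inr (j, _, i) then if i < len j then lab i else j.*2.+1 else lam.

Definition uadj : rel pos := fun p q =>
  match p, q with
  | inl v, inl w => nat_step v w
  | inl v, inr (j, b, i) => (i == 0 :> nat) && (v == j + b :> nat)
  | inr (j, b, i), inl v => (i == 0 :> nat) && (v == j + b :> nat)
  | inr (j, b, i), inr (j', b', i') =>
      (j == j') && (if b == b' then [&& nat_step i i', i <= len j & i' <= len j]
                    else (i == len j :> nat) && (i' == len j :> nat))
  end.

Lemma lev_lam (j : 'I_nlev) : j.*2.+2 <= lam.
Proof. by have := ltn_ord j; rewrite /lam; lia. Qed.

Lemma len_le (j : 'I_nlev) : len j <= st lam.
Proof. exact/st_mono/lev_lam. Qed.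

Lemma len_gt0 j : 0 < len j.
Proof.
have : st 1 <= len j by apply: st_mono.
by rewrite st1; have := lam_gt1 N; lia.
Qed.

Lemma len_lt_max (j : 'I_nlev) : len j < maxlen.
Proof. by rewrite ltnS len_le. Qed.

Lemma lab_len (j : 'I_nlev) : lab (len j).-1 = j.*2.+1.
Proof. by rewrite /len lab_last //; have := lev_lam j; lia. Qed.

Lemma uadj_sym : symmetric uadj.
Proof.
case=> [v|[[j b] i]] [w|[[j' b'] i']] //=; first exact: nat_stepC.
rewrite [j' == j]eq_sym [b' == b]eq_sym; case: eqP => //= <-.
by case: eqP => _; rewrite 1?nat_stepC 1?[(_ <= _) && _]andbC // andbC.
Qed.

Lemma uadj_irr : irreflexive uadj.
Proof. by case=> [v|[[j b] i]] /=; rewrite ?eqxx /nat_step /=; lia. Qed.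

Lemma uadj_lip p q : uadj p q -> lip (mu p) (mu q).
Proof.
case: p => [v|[[j b] i]]; case: q => [w|[[j' b'] i']] /=.
- by rewrite /lip; lia.
- by case/andP=> /eqP-> _; rewrite len_gt0 lab_first /lip; have := lam_gt1 N; lia.
- by case/andP=> /eqP-> _; rewrite len_gt0 lab_first /lip; have := lam_gt1 N; lia.
case/andP=> /eqP<-; case: eqP => _; last first.
  by case/andP=> /eqP-> /eqP->; rewrite ltnn /lip; lia.
wlog: i i' / i' == i.+1 :> nat => [H /and3P[h1 h2 h3]|].
  case/orP: (h1) => h; first by apply: H; rewrite // h1 h2.
  by rewrite /lip andbC; apply: H; rewrite // nat_stepC h1 h2 h3.
move/eqP=> E /and3P[_ h2 h3]; rewrite E in h3 *; rewrite h3.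
have := len_le j; case: ltnP => h hl; first by apply: lab_lip; lia.
have -> : i = (len j).-1 :> nat by lia.
by rewrite lab_len /lip; lia.
Qed.

Lemma isslot_mu e p : isslot e p -> mu p = e.
Proof. by case: p => [v|[[j b] i]] //= /andP[-> /eqP]. Qed.

Lemma isgate_mu e p : isgate e p -> mu p = e./2.*2.+1.
Proof.
case: p => [v|[[j b] i]] //= /andP[/eqP-> /eqP->]; rewrite ltnn.
by case: b => /=; lia.
Qed.

Lemma isgate_not_slot e e' p : isgate e p -> ~~ isslot e' p.
Proof. by case: p => [v|[[j b] i]] //= /andP[/eqP-> _]; rewrite ltnn. Qed.

(** Off the slots, only gates and padding have a value below [lam]. The neighbours of a gate are its
    twin and the last slot of its leg, both of the same value. So crossing the value [e] requires an
    [e]-slot. *)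
Lemma mu_notslot e p : mu p = e -> e < lam -> ~~ isslot e p ->
  forall q, uadj p q -> e <= mu q.
Proof.
case: p => [v|[[j b] i]] /=; first by move=> <-; lia.
case: ifP => [h1 -> _|h1 E _ _ q]; first by rewrite eqxx.
case: q => [v|[[j' b'] i']] /=; first by case/andP=> /eqP h; move: h1; rewrite h len_gt0.
case/andP=> /eqP<-; case: eqP => _; last first.
  by case/andP=> _ /eqP->; rewrite ltnn -E.
case/and3P=> /orP[]/eqP h h2 h3; case: ifP => h4; rewrite -?E //; first by lia.
have -> : i' = (len j).-1 :> nat by lia.
by rewrite lab_len.
Qed.

(** This edge between twin gates is the chord that keeps an induced path from returning out of an
    attached copy. *)
Lemma gate_adj e e' p q :
  isgate e p -> isgate e' q -> e./2 = e'./2 -> p != q -> uadj p q.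
Proof.
case: p => [v|[[j b] i]] //=; case: q => [w|[[j' b'] i']] //=.
case/andP=> /eqP hi /eqP he /andP[/eqP hi' /eqP he'] E n.
have jj : j = j' by apply: val_inj => /=; move: E; rewrite he he'; case: b b' {n he he'} => [] []; lia.
subst j'; rewrite eqxx hi hi' eqxx /=; case: eqP => // bb; subst b'.
by case/negP: n; apply/eqP; congr (inr (_, _)); apply: val_inj; rewrite /= hi hi'.
Qed.

Lemma gate_inj e p q : isgate e p -> isgate e q -> p = q.
Proof.
case: p => [v|[[j b] i]] //=; case: q => [w|[[j' b'] i']] //=.
case/andP=> /eqP hi /eqP he /andP[/eqP hi' /eqP he'].
have [jj bb] : j = j' :> nat /\ b = b' by move: he'; rewrite he; case: b b' {he} => [] []; split; lia.
have {}jj := val_inj jj; subst j' b'.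
by congr (inr (_, _)); apply: val_inj; rewrite /= hi hi'.
Qed.

(** * Paths inside a single unit *)

Definition mount (p : pos) : option 'I_nlev :=
  if p is inr (j, _, _) then Some j else None.

Definition valid (p : pos) := if p is inr (j, _, i) then i <= len j else true.

Lemma uadj_valid p q : uadj p q -> valid p && valid q.
Proof.
case: p => [v|[[j b] i]]; case: q => [w|[[j' b'] i']] //=.
- by case/andP=> /eqP->.
- by case/andP=> /eqP->.
- case/andP=> /eqP<-; case: eqP => _; first by case/and3P=> _ -> ->.
  by case/andP=> /eqP-> /eqP->; rewrite leqnn.
Qed.

Lemma size_legs (j : 'I_nlev) (I : seq nat) (s : seq pos) : uniq s ->
  {in s, forall p, exists (b : bool) (i : 'I_maxlen), p = inr (j, b, i) /\ (i : nat) \in I} ->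
  size s <= (size I).*2.
Proof.
move=> us H; pose f (p : pos) : bool * nat :=
  if p is inr (_, b, i) then (b, val i) else (false, 0).
have : uniq (map f s).
  rewrite map_inj_in_uniq // => p q /H[b [i [-> _]]] /H[b' [i' [-> _]]] [-> E].
  by congr (inr (_, _)); apply: val_inj.
move/(@uniq_leq_size _ _ [seq (b, i) | b <- [:: false; true], i <- I]).
rewrite size_map size_allpairs mul2n; apply=> x /mapP[p /H[b [i [-> iI]]] ->].
by apply/allpairsP; exists (b, val i); split=> //; case: (b).
Qed.

Lemma mount_const s : sorted uadj s -> {in s, forall p, mount p != None} ->
  {in s &, forall p q, mount p = mount q}.
Proof.
move=> so H; apply: (@sorted_const _ uadj) so => -[v|[[j b] i]] [w|[[j' b'] i']] //=.
- by move=> /H.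
- by move=> _ /H.
- by move=> _ _ /andP[/eqP->].
Qed.

Lemma low_mount (s : seq pos) c : c <= lam -> {in s, forall p, mu p < c} ->
  {in s, forall p, mount p != None}.
Proof. by move=> cl H [v|[[j b] i]] // /H /=; lia. Qed.

Lemma size_mount s : uniq s -> sorted uadj s ->
  {in s, forall p, mount p != None} -> size s <= maxlen.*2.
Proof.
case: s => // p s us so H.
have : mount p != None by rewrite H ?inE ?eqxx.
case E: (mount p) => [j|] // _.
have := @size_legs j (iota 0 maxlen) (p :: s) us; rewrite size_iota; apply=> q qs.
have := mount_const so H qs (mem_head p s); rewrite E.
case: q qs => [v|[[j' b] i]] // _ [->]; exists b, i.
by split=> //; rewrite mem_iota ltn_ord.
Qed.

(** The mountains are cells in the sense of [ipath_cells], because the two feet of a mountain are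
    consecutive valleys. So the valleys are visited in one run, with at most one mountain on either
    side of it. *)
Lemma size_ipath_unit s : ipath uadj s -> size s <= maxlen.*2.*2 + nlev.+1.
Proof.
move=> ip; pose O (p : pos) := if p is inl _ then true else false.
have [||t1 [Q [t2 [E OQ O1 O2 _]]]] := @ipath_cells _ uadj _ O mount s _ _ ip.
- by case=> [v|[[j b] i]] // [w|[[j' b'] i']] // _ _ /andP[/eqP->].
- move=> [v|] // [w|] // [|[[j b] i]] // [|[[j' b'] i']] // _ _ vw _ _.
  case/andP=> _ /eqP hv /andP[_ /eqP hw] [jj]; subst j'.
  have : v != w :> nat by apply: contraNneq vw => /val_inj->.
  by rewrite /= hv hw /nat_step; case: b b' {hv hw} => [] [] /=; lia.
have [u so _] := ip; rewrite E !size_cat.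
have [u1 uQ u2] : [/\ uniq t1, uniq Q & uniq t2].
  by move: u; rewrite E !cat_uniq => /and3P[-> _ /and3P[-> _ ->]].
have s1 : size t1 <= maxlen.*2.
  apply: size_mount => //; first by apply: (@sorted_infix _ _ [::] _ (Q ++ t2)); rewrite -E.
  by case=> [v|[[j b] i]] // /(allP O1).
have s2 : size t2 <= maxlen.*2.
  apply: size_mount => //.
    by apply: (@sorted_infix _ _ (t1 ++ Q) _ [::]); rewrite cats0 -catA -E.
  by case=> [v|[[j b] i]] // /(allP O2).
have sQ : size Q <= nlev.+1.
  have := @uniq_leq_size _ Q [seq inl v | v <- enum 'I_nlev.+1] uQ.
  rewrite size_map -cardE card_ord; apply=> -[v|x] /(allP OQ) // _.
  by apply/mapP; exists v; rewrite // mem_enum.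
by lia.
Qed.

(** Unfolds a mountain into a line: up the leg [false], across the gates at [len j] and [len j + 1],
    down the leg [true]. *)
Definition crd (p : pos) : nat :=
  if p is inr (j, b, i) then if b then (len j).*2.+1 - i else i else 0.

Lemma uadj_crd p q : mount p != None -> mount q != None -> uadj p q ->
  nat_step (crd p) (crd q).
Proof.
case: p => [|[[j b] i]] //; case: q => [|[[j' b'] i']] // _ _ /= /andP[/eqP<-].
case: (b) (b') => [] [] /=; rewrite /nat_step /=; lia.
Qed.

Lemma line_cover (s : seq pos) (j : 'I_nlev) p q w :
  sorted uadj s -> {in s, forall p, mount p != None} ->
  p \in s -> q \in s -> mount p = Some j -> valid p -> crd p <= w <= crd q ->
  exists (b : bool) (i : 'I_maxlen), [/\ inr (j, b, i) \in s, i <= len j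
    & w = if b then (len j).*2.+1 - i else i].
Proof.
move=> so H ps qs mp vp pwq.
have Hv : {in s, forall p, valid p}.
  have /(_ _ _ _ ps) E : {in s &, forall p q, valid p = valid q}.
    by apply: (@sorted_const _ uadj) so => p' q' _ _ /uadj_valid/andP[-> ->].
  by move=> r /E->.
have so' : sorted nat_step (map crd s).
  rewrite sorted_map; move: so H {ps qs Hv}; case: s => //= x s.
  elim: s x => //= y s IH x /andP[xy so] H.
  rewrite uadj_crd ?H ?inE ?eqxx ?orbT //= IH // => r rs.
  by apply: H; rewrite inE rs orbT.
have /mapP[r rs ->] := nat_step_cover so' (map_f crd ps) (map_f crd qs) pwq.
have := mount_const so H rs ps; have := Hv r rs; rewrite mp.
by case: r rs => [v|[[j'' b] i]] //= rs hv [E]; subst j''; exists b, i.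
Qed.

(** Intermediate values of [crd]: both gates lie beyond every slot of either leg. *)
Lemma leg_cover (s : seq pos) (j : 'I_nlev) b i b' i' z :
  sorted uadj s -> {in s, forall p, mount p != None} ->
  inr (j, b, i) \in s -> inr (j, b', i') \in s ->
  i' = len j :> nat \/ b' = b /\ z <= i' <= len j ->
  i <= len j -> i <= z < len j ->
  exists2 i'' : 'I_maxlen, inr (j, b, i'') \in s & i'' = z :> nat.
Proof.
move=> so H ps qs hi' hi /andP[iz zl].
have vq : i' <= len j by case: hi' => [->//|[_ /andP[]]].
case: b ps hi' => ps hi'.
- have [|||b'' [i'' [h1 h2 h3]]] := @line_cover s j _ _ ((len j).*2.+1 - z) so H qs ps.
  + by [].
  + by [].
  + by rewrite /=; case: (b') hi'; lia.
  + by exists i''; case: b'' h1 h3 => // *; lia.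
- have [|||b'' [i'' [h1 h2 h3]]] := @line_cover s j _ _ z so H ps qs.
  + by [].
  + by [].
  + by rewrite /=; case: (b') hi'; lia.
  + by exists i''; case: b'' h1 h3 => // *; lia.
Qed.

(** The gate lies above block [e]. To get down from there, the path would have to use the last slot
    of block [e] on some leg, which is labelled [e]. *)
Lemma zone (s : seq pos) e g p : sorted uadj s -> {in s, forall q, ~~ isslot e q} ->
  p \in s -> isgate g p -> e <= g./2.*2.+1 ->
  exists j : 'I_nlev, g./2 = j /\ {in s, forall q, exists (b : bool) (i : 'I_maxlen),
     [/\ q = inr (j, b, i), st e.+1 <= i & i <= len j]}.
Proof.
move=> so H ps gp eg.
have [j gj] : exists j : 'I_nlev, g./2 = j.
  case: p gp ps => [v|[[j b] i]] //= /andP[_ /eqP->] _; exists j.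
  by case: (b) => /=; lia.
exists j; split=> //; rewrite gj in eg.
pose Z (q : pos) := if q is inr (j', b, i) then [&& j' == j, st e.+1 <= i & i <= len j] else false.
have se : 0 < st e.+1.
  have : st 1 <= st e.+1 by apply: st_mono.
  by rewrite st1; have := lam_gt1 N; lia.
have sl : st e.+1 <= len j by apply: st_mono; lia.
have K : forall x y, y \in s -> uadj x y -> Z x -> Z y.
  move=> [v|[[j1 b1] i1]] // [w|[[j2 b2] i2]] ys /=.
    by case/andP=> /eqP-> _ /and3P[_ h _]; lia.
  case/andP=> /eqP jj; subst j2; case: eqP => _; last first.
    by case/andP=> /eqP h1 /eqP h2 /and3P[-> h3 h4]; rewrite /= h2 -h1 h3 h4.
  case/and3P=> ss h1 h2 /and3P[/eqP E h3 h4]; subst j1; rewrite eqxx h2 andbT /=.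
  rewrite leqNgt; apply/negP => h5.
  have := H _ ys => /=; case/negP.
  have -> : i2 = (st e.+1).-1 :> nat by move: ss; rewrite /nat_step /=; lia.
  rewrite lab_last ?eqxx ?andbT; first by lia.
  by have := lev_lam j; lia.
have ZE : {in s &, forall x y, Z x = Z y}.
  apply: (@sorted_const _ uadj) so => x y xs ys xy.
  by apply/idP/idP; [apply: K|apply: K => //; rewrite uadj_sym].
have Zp : Z p.
  case: p gp ps => [v|[[j' b] i]] //= /andP[/eqP hi /eqP hg] _.
  have jj : j' = j by apply: val_inj => /=; rewrite -gj hg; case: (b); lia.
  by subst j'; rewrite eqxx hi leqnn sl.
move=> q qs; have : Z q by rewrite (ZE _ _ qs ps).
by case: q {qs} => [v|[[j' b] i]] //= /and3P[/eqP-> h1 h2]; exists b, i.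
Qed.

Lemma size_zone (s : seq pos) (j : 'I_nlev) a c : uniq s -> a <= j.*2.+2 ->
  {in s, forall q, exists (b : bool) (i : 'I_maxlen), [/\ q = inr (j, b, i), st a <= i & i <= len j]} ->
  {in s, forall q l, isslot l q -> l < c} ->
  size s <= (\sum_(a <= y < j.*2.+2) nbelow c y).*2.+2.
Proof.
move=> us al H Hc; rewrite -count_lab; last by rewrite al lev_lam.
(* The extra height is that of the gates; the doubling is for the two legs. *)
set I := iota _ _; rewrite -[_.*2.+2]/(_.+1.*2) -size_filter.
rewrite -/(size (len j :: [seq i <- I | lab i < c])).
apply: (@size_legs j) => // q qs; have [b [i [E h1 h2]]] := H q qs.
exists b, i; split=> //; rewrite inE; case: eqP => //= /eqP n.
have il : i < len j by lia.
rewrite mem_filter (Hc q qs) ?E /= ?il ?eqxx // mem_iota h1 /=.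
by move: il; rewrite /len; lia.
Qed.

(* A path from a slot labelled e to a gate that avoids all other e-slots stays
   above the last e-slot of the legs. *)
Lemma link_bound (x : pos) (R : seq pos) e g c : uniq (x :: R) ->
  sorted uadj (x :: R) -> isslot e x -> {in R, forall q, ~~ isslot e q} ->
  isgate g (last x R) -> e <= g./2.*2.+1 ->
  {in x :: R, forall q l, isslot l q -> l < c} ->
  size (x :: R) <= (\sum_(e.+1 <= y < g./2.*2.+2) nbelow c y).*2 + 3.
Proof.
case: R => [|y R] us so sx H gl eg Hc.
  by have := isgate_not_slot e gl; rewrite /= sx.
have soR : sorted uadj (y :: R) by case/andP: so.
have [j [gj Z]] := zone soR H (mem_last y R) gl eg.
rewrite gj /= addnS ltnS addn2; apply: (@size_zone (y :: R) j) => //.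
- by case/andP: us.
- by rewrite -gj; lia.
- by move=> q qs; apply: Hc; rewrite inE qs orbT.
Qed.

(** After its first slot the link stays above block [e] by [zone], and it ends at a gate; so it
    climbs each later block of its leg entirely. *)
Lemma link_cover (x : pos) (R : seq pos) e g y l :
  sorted uadj (x :: R) -> isslot e x -> {in R, forall q, ~~ isslot e q} ->
  isgate g (last x R) -> e < y <= g./2.*2.+1 -> l \in exc y ->
  exists2 q, q \in x :: R & isslot l q.
Proof.
case: R => [|r R] so sx H gl /andP[ey yg] ly.
  by have := isgate_not_slot e gl; rewrite /= sx.
have soR : sorted uadj (r :: R) by case/andP: so.
have [|j [gj Z]] := zone soR H (mem_last r R) gl; first by lia.
have [b [i [Er h1 h2]]] := Z r (mem_head _ _).
have xr : uadj x r by case/andP: so.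
case: x so sx xr gl => [v|[[j0 b0] i0]] // so sx xr gl.
have jj : j0 = j by move: xr; rewrite Er /= => /andP[/eqP].
subst j0; have [b' [i' [El h3 h4]]] := Z _ (mem_last r R).
have hi' : i' = len j :> nat by move: gl; rewrite /= El /= => /andP[/eqP].
have /andP[i0l /eqP labi] := sx.
have i0e : i0 < st e.+1.
  rewrite ltnNge; apply/negP => h; have := lab_ge h; rewrite labi.
  by have := len_le j; move: i0l; lia.
have yl : y < lam by have := lev_lam j; rewrite -gj; lia.
have [k /andP[k1 k2] lk] := exc_at yl ly.
have sy : st y.+1 <= len j by apply: st_mono; rewrite -gj; lia.
have ye : st e.+1 <= st y by apply: st_mono.
have [|||||i'' qs hk] := @leg_cover (inr (j, b0, i0) :: r :: R) j b0 i0 b' i' k so _ _ _ (or_introl hi').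
- move=> q; rewrite inE => /orP[/eqP->//|/Z[b1 [i1 [-> _ _]]]] //.
- exact: mem_head.
- by rewrite inE -El mem_last orbT.
- exact: ltnW.
- by lia.
- by exists (inr (j, b0, i'')); rewrite //= hk lk eqxx andbT; lia.
Qed.

(** The confinement of [zone], with a [c]-slot inside block [x] as the barrier instead of the end of
    a block. *)
Lemma zone_hit (s : seq pos) c x g p : sorted uadj s ->
  {in s, forall q, mount q != None} -> {in s, forall q, ~~ isslot c q} ->
  p \in s -> isgate g p -> c \in exc x -> x <= g./2.*2.+1 ->
  exists j : 'I_nlev, g./2 = j /\ {in s, forall q, exists (b : bool) (i : 'I_maxlen),
     [/\ q = inr (j, b, i), st x <= i & i <= len j]}.
Proof.
move=> so H Hc ps gp cx xg.
case: p gp ps => [v|[[j b'] i']] //= /andP[/eqP hi' /eqP hg] ps.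
have gj : g./2 = j by rewrite hg; case: (b') => /=; lia.
exists j; split=> // q qs; have := mount_const so H qs ps.
have vq : valid q.
  have -> : valid q = valid (inr (j, b', i')).
    by apply: (@sorted_const _ uadj) so _ _ qs ps => y z _ _ /uadj_valid/andP[-> ->].
  by rewrite /= hi'.
case: q qs vq => [v|[[j0 b] i]] //= qs vq [E]; subst j0; exists b, i; split=> //.
rewrite leqNgt; apply/negP => ix; rewrite gj in xg.
have xl : x < lam by have := lev_lam j; lia.
have [k /andP[k1 k2] lk] := exc_at xl cx.
have sx : st x.+1 <= len j by apply: st_mono.
have [||i'' rs hk] := @leg_cover s j b i b' i' k so H qs ps (or_introl hi'); try lia.
by have := Hc _ rs; rewrite /= hk lk eqxx andbT; lia.
Qed.

Lemma isslot_lt e p : isslot e p -> e < lam.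
Proof.
case: p => [v|[[j b] i]] //= /andP[h /eqP<-].
have : i < st lam by have := len_le j; lia.
case/block_of=> y yl /(lab_mem yl); rewrite exc_mem /hgt; lia.
Qed.

Definition blk_idx e c y :=
  [seq k <- iota (st y) (size (exc y)) | e <= lab k < c].

Lemma size_blk_idx e c y : y < lam -> size (blk_idx e c y) <= (c - e).*2.
Proof.
move=> yl; rewrite size_filter.
have -> : count (fun k => e <= lab k < c) (iota (st y) (size (exc y)))
    = count (fun l => e <= l < c) (exc y).
  rewrite -(count_map lab (fun l => e <= l < c)); congr count.
  apply: (@eq_from_nth _ 0); rewrite size_map size_iota // => i hi.
  by rewrite (nth_map 0) ?size_iota // nth_iota // lab_block.
have K a n : count (fun l => e <= l < c) (iota a n) <= c - maxn e a.
  by elim: n a => //= n IH a; have := IH a.+1; case: (leqP e a); case: (ltnP a c); lia.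
rewrite /exc count_cat count_rev; have := K y (hgt N y).
by case: ifP => _ /=; lia.
Qed.

Lemma one_block (s : seq pos) (j : 'I_nlev) e b : sorted uadj s ->
  {in s, forall q, mount q != None} -> {in s, forall q, e <= mu q} ->
  e < lam ->
  exists2 y, y < lam & forall i : 'I_maxlen, inr (j, b, i) \in s -> i < st e.+1 ->
    i < len j -> st y <= i < st y.+1.
Proof.
move=> so H He el.
pose lo (q : pos) := if q is inr (j', b', i)
  then [&& j' == j, b' == b, i < st e.+1 & i < len j] else false.
have [/hasP[q qs lq]|/hasPn nh] := boolP (has lo s); last first.
  exists e => // i qs h1 h2; have := nh _ qs; rewrite /= !eqxx h1 h2 //.
case: q qs lq => [//|[[j' b'] i]] qs /= /and4P[/eqP E1 /eqP E2 h1 h2]; subst j' b'.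
have [y ye hy] := block_of h1; exists y; first by lia.
move=> i' qs' h1' h2'; have [y' ye' hy'] := block_of h1'.
suff -> : y = y' by [].
have K : forall (y y' : nat) (i i' : 'I_maxlen), inr (j, b, i) \in s -> inr (j, b, i') \in s ->
    i < len j -> i' < len j -> st y <= i < st y.+1 -> st y' <= i' < st y'.+1 ->
    y' < e.+1 -> y < y' -> False.
  move=> {i i' qs qs' h1 h2 h1' h2' y y' ye ye' hy hy'} y y' i i' qs qs' l l' /andP[hy1 hy2] /andP[hy1' _] ye yy.
  have syy := st_mono N yy.
  have [|||i'' rs hk] := @leg_cover s j b i b i' (st y.+1).-1 so H qs qs'; try lia.
  have := He _ rs; rewrite /= hk lab_last; last by lia.
  by rewrite ifT; lia.
case: (ltngtP y y') => // yy; exfalso.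
- exact: (K y y' i i').
- exact: (K y' y i' i).
Qed.

(* Below block e+1 such a path stays within one block of each leg, since every
   block y ends with a slot labelled y. *)
Lemma high_bound (s : seq pos) e c : uniq s -> sorted uadj s ->
  {in s, forall q, e <= mu q} -> {in s, forall q, mu q < c} -> c <= lam -> s != [::] ->
  size s <= (\sum_(e.+1 <= y < lam) nbelow c y).*2 + 8 * (c - e) + 2.
Proof.
move=> us so He Hc cl s0; have H := low_mount cl Hc.
case: (leqP (size s) 1) => [h|s2]; first by apply: leq_trans h _; lia.
have Hv : {in s, forall q, valid q}.
  have K : {in s &, forall p q, valid p = valid q}.
    by apply: (@sorted_const _ uadj) so => p q _ _ /uadj_valid/andP[-> ->].
  case: s s2 so K {us He Hc s0 H} => [|p [|q s]] // _ /andP[/uadj_valid/andP[vp _] _] K r rs.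
  by rewrite (K r p) // mem_head.
have [j Hj] : exists j : 'I_nlev, {in s, forall q, mount q = Some j}.
  case: s s0 H so {us He Hc s2 Hv} => // q s _ H so.
  have : mount q != None by rewrite H ?mem_head.
  by case E: (mount q) => [j|] // _; exists j => r rs; rewrite (mount_const so H rs (mem_head q s)).
have el : e < lam.
  by case: s s0 {us so H Hj s2 Hv} He Hc => // q s _ /(_ q) h1 /(_ q) h2; move: h1 h2; rewrite mem_head => /(_ isT) ? /(_ isT); lia.
have [y0 y0l h0] := @one_block s j e false so H He el.
have [y1 y1l h1] := @one_block s j e true so H He el.
(* From block [e+1] on, slots are counted by [nbelow]; below it, each leg offers a single block with
   at most [2(c - e)] usable slots. *)
pose hi := [seq k <- iota (st e.+1) (st lam - st e.+1) | lab k < c].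
have shi : size hi = \sum_(e.+1 <= y < lam) nbelow c y.
  by rewrite size_filter count_lab // el /=.
have := size_blk_idx e c y0l; have := size_blk_idx e c y1l.
have : size s <= (size (len j :: hi ++ blk_idx e c y0 ++ blk_idx e c y1)).*2.
  apply: (@size_legs j) => // q qs.
  have := Hj q qs; have := Hc q qs; have := He q qs; have := Hv q qs.
  case: q qs => [//|[[j' b] i]] qs /= vq h2 h3 [E]; subst j'; exists b, i; split=> //.
  rewrite inE; case: eqP => [//|ne]; have il : i < len j by lia.
  have ll := len_le j; rewrite il in h2 h3; rewrite !mem_cat.
  case: (leqP (st e.+1) i) => hst.
    by rewrite mem_filter h3 mem_iota hst /=; lia.
  apply/orP; right.
  case: b qs => qs; [have := h1 i qs hst il|have := h0 i qs hst il].
  - by rewrite st_S /blk_idx !mem_filter !mem_iota h2 h3 /= => ->; rewrite ?orbT.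
  - by rewrite st_S /blk_idx !mem_filter !mem_iota h2 h3 /= => ->; rewrite orbT.
by rewrite /= !size_cat shi; lia.
Qed.

End Unit.

(** * The graphs [G_m] and the decomposition of their induced paths *)

Section Graph.
Variable N : nat.
Local Notation nlev := (nlev N).
Local Notation lam := (lam N).
Local Notation pos := (pos N).

(* [inr (u, w)] is the unit w of the copy attached to the unit u. *)
Fixpoint node (m : nat) : finType :=
  if m is m'.+1 then (node m' + node m' * node m')%type else unit.

Definition vtx m : finType := (node m * pos)%type.

Definition att m (p q : pos) :=
  isgate m.*2 p && isslot m.*2 q || isgate m.*2.+1 p && isslot m.*2.+1 q.

Fixpoint gadj m : rel (vtx m) :=
  match m return rel (vtx m) with
  | 0 => fun x y => uadj x.2 y.2
  | m'.+1 => fun x y =>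
    match x.1, y.1 with
    | inl u, inl u' => gadj (u, x.2) (u', y.2)
    | inr (u, w), inr (u', w') => (u == u') && gadj (w, x.2) (w', y.2)
    | inl u, inr (u', _) => (u == u') && att m' x.2 y.2
    | inr (u', _), inl u => (u == u') && att m' y.2 x.2
    end
  end.

Lemma attP m p q : att m p q ->
  exists e, [/\ e./2 = m, isgate e p & isslot e q].
Proof.
case/orP=> /andP[h1 h2]; first by exists m.*2; rewrite doubleK.
by exists m.*2.+1; split=> //; lia.
Qed.

Lemma attI m e p q : e./2 = m -> isgate e p -> isslot e q -> att m p q.
Proof.
move=> <- h1 h2; rewrite /att; have [E|E] : e = e./2.*2 \/ e = e./2.*2.+1 by lia.
  by rewrite -E h1 h2.
by rewrite -E h1 h2 orbT.
Qed.

Lemma gadj_sym m : symmetric (@gadj m).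
Proof.
elim: m => [|m IH] [t p] [t' q]; first exact: uadj_sym.
by rewrite /=; case: t => [u|[u w]]; case: t' => [u'|[u' w']]; rewrite // IH eq_sym.
Qed.

Lemma gadj_irr m : irreflexive (@gadj m).
Proof.
elim: m => [|m IH] [t p]; first exact: uadj_irr.
by rewrite /=; case: t => [u|[u w]]; rewrite IH ?andbF.
Qed.

Lemma gadj_unit m (t : node m) p q : gadj (t, p) (t, q) = uadj p q.
Proof.
by elim: m t => [|m IH] // [u|[u w]] /=; rewrite ?eqxx IH.
Qed.

Lemma gadjE m (x y : vtx m) : gadj x y ->
  x.1 = y.1 /\ uadj x.2 y.2 \/
  exists2 e, e./2 < m & isgate e x.2 /\ isslot e y.2 \/ isslot e x.2 /\ isgate e y.2.
Proof.
elim: m x y => [|m IH] [t p] [t' q]; first by left; case: (t) (t') => [] [].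
rewrite /=; case: t => [u|[u w]]; case: t' => [u'|[u' w']].
- by case/IH=> [[/= -> h]|[e h1 h2]]; [left|right; exists e => //; apply: ltnW].
- by case/andP=> _ /attP[e [E h1 h2]]; right; exists e; [rewrite E|left].
- by case/andP=> _ /attP[e [E h1 h2]]; right; exists e; [rewrite E|right].
- case/andP=> /eqP-> /IH[[/= -> h]|[e h1 h2]]; [by left|right; exists e => //].
  exact: ltnW.
Qed.

Lemma gadj_slot m e (x y : vtx m) : m <= e./2 -> isslot e x.2 -> gadj x y ->
  x.1 = y.1 /\ uadj x.2 y.2.
Proof.
move=> me sx /gadjE[//|[e' h [[gx _]|[/isslot_mu]]]].
  by have := isgate_not_slot e gx; rewrite sx.
by rewrite (isslot_mu sx) => E; move: h; rewrite -E; lia.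
Qed.

(** An edge between two units joins a gate and a slot whose label is below [2m], so both values are
    below [2m <= e]. *)
Lemma gadj_low m e (x y : vtx m) : m <= e./2 -> gadj x y -> e <= mu x.2 ->
  x.1 = y.1 /\ uadj x.2 y.2.
Proof.
move=> me /gadjE[//|[e' h [[/isgate_mu -> _]|[/isslot_mu -> _]]]] ?; exfalso; lia.
Qed.

(** Edges between units have both ends below [e]. Inside a unit, an edge leading up from below [e]
    would end at value exactly [e], which [mu_notslot] allows only at an [e]-slot. *)
Lemma gadj_sep m e (s : seq (vtx m)) : m <= e./2 -> e < lam -> sorted (@gadj m) s ->
  {in s, forall x, ~~ isslot e x.2} -> {in s &, forall x y, (mu x.2 < e) = (mu y.2 < e)}.
Proof.
move=> me el so H; apply: (@sorted_const _ (@gadj m)) so.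
suff K : {in s &, forall x y, gadj x y -> mu x.2 < e -> mu y.2 < e}.
  move=> x y xs ys xy; apply/idP/idP; first exact: K.
  by apply: K; rewrite // gadj_sym.
move=> x y xs ys; rewrite gadj_sym => yx hx; rewrite ltnNge; apply/negP => hy.
have [_ u] := gadj_low me yx hy.
have Ey : mu y.2 = e by have := uadj_lip u; rewrite /lip; lia.
by have := mu_notslot Ey el (H y ys) u; rewrite leqNgt hx.
Qed.

Lemma same_unit m (s : seq (vtx m)) :
  sorted (@gadj m) s -> {in s &, forall x y, gadj x y -> x.1 = y.1 /\ uadj x.2 y.2} ->
  {in s &, forall x y, x.1 = y.1} /\ sorted (@uadj N) (map snd s).
Proof.
move=> so H; split.
  by apply: (@sorted_const _ (@gadj m)) so => x y xs ys /H[].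
rewrite sorted_map; case: s so H => //= x s; elim: s x => //= y s IH x.
case/andP=> xy so H; have [|||_ ->] := H x y; rewrite ?inE ?eqxx ?orbT //=.
by apply: IH => // a b ha hb; apply: H; rewrite inE ?ha ?hb orbT.
Qed.

Lemma ipath_same_unit m (s : seq (vtx m)) :
  {in s &, forall x y, x.1 = y.1} -> ipath (@gadj m) s -> ipath (@uadj N) (map snd s).
Proof.
case: s => [|[t p] s] H ip; first by split=> // -[].
apply: (@ipath_map _ _ (@uadj N) (@gadj m) (fun q => (t, q))) => [q q'|].
  exact: gadj_unit.
rewrite -map_comp map_id_in // => -[t' q] xs /=.
by have /= -> := H _ _ xs (mem_head _ _).
Qed.

(* Only the positions within the units matter for the size of a path: [tail e R]
   is what follows a descent through a gate labelled e, [chain z e B] is a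
   sequence of completed descents after z, ending at a gate labelled e. *)
Definition tail e (R : seq pos) := exists m (r : seq (vtx m)) x R',
  [/\ e./2 = m, ipath (@gadj m) r, map snd r = R, R = x :: R' &
      isslot e x /\ {in R', forall q, ~~ isslot e q}].

Inductive chain (z : pos) : nat -> seq pos -> Prop :=
| chain0 e : isgate e z -> chain z e [::]
| chainS e' e B R : chain z e' B -> e'./2 < e./2 -> tail e' R ->
    isgate e (last z R) -> chain z e (B ++ R).

(** One side of the core: completed descents, then a last one that need not end at a gate. *)
Definition rside m z (B : seq pos) := B = [::] \/
  exists e B1 R, [/\ e./2 < m, chain z e B1, tail e R & B = B1 ++ R].

Lemma rsideW m z B : rside m z B -> rside m.+1 z B.
Proof.
case=> [->|[e [B1 [R [h1 h2 h3 ->]]]]]; [by left|right].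
by exists e, B1, R; split=> //; apply: ltnW.
Qed.

Lemma rside_ext m z B t : rside m z B ->
  (t = [::] \/ exists e, [/\ e./2 = m, isgate e (last z B) & tail e t]) ->
  rside m.+1 z (B ++ t).
Proof.
move=> h [->|[e [E gz tt]]]; first by rewrite cats0; apply: rsideW.
right; exists e, B, t; rewrite E; split=> //.
case: h gz => [->|[e' [B1 [R [h1 h2 h3 ->]]]]] gz; first exact: chain0.
apply: (chainS h2) => //; first by rewrite E.
by case: h3 gz => m' [r [x [R' [_ _ _ -> _]]]]; rewrite last_cat.
Qed.

(** Here [o] is the last vertex before the path enters an attached copy. It is a gate joined to all
    slots of its label [e] there, so chordlessness leaves the entry as the only [e]-slot. *)
Lemma ipath_tail m (o : vtx m.+1) (u : node m) (t : seq (vtx m.+1)) :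
  ipath (@gadj m.+1) (o :: t) -> o.1 = inl u ->
  {in t, forall x : vtx m.+1, if x.1 is inr _ then true else false} ->
  map snd t = [::] \/ exists e, [/\ e./2 = m, isgate e o.2 & tail e (map snd t)].
Proof.
case: o => [t0 p] ip /= ?; subst t0; case: t ip => [|a t] ip H; [by left|right].
have [us so ch] := ip; have oa : @gadj m.+1 (inl u, p) a by case/andP: so.
have [w [q Ea]] : exists w q, a = (inr (u, w), q).
  case: a oa {so ip ch us} H => [[u'|[u' w]] q] H0 H.
    by have := H _ (mem_head _ _).
  by move: H0 => /= /andP[/eqP <- _]; exists w, q.
have [e [E ge se]] : exists e, [/\ e./2 = m, isgate e p & isslot e q].
  by move: oa; rewrite Ea /= eqxx; apply: attP.
exists e; split=> //.
have cl : {in a :: t, forall b : vtx m.+1, exists w' q', b = (inr (u, w'), q')}.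
  pose f (b : vtx m.+1) := if b.1 is inr (u', _) then Some u' else None.
  have so' : sorted (@gadj m.+1) (a :: t) by case/andP: so.
  have K : {in a :: t &, forall x y, f x = f y}.
    apply: (@sorted_const _ (@gadj m.+1)) so' => -[[u1|[u1 w1]] q1] [[u2|[u2 w2]] q2] h1 h2 //.
    - by have := H _ h1.
    - by have := H _ h2.
    - by rewrite /f /= => /andP[/eqP->].
  move=> b bs; have := K _ _ bs (mem_head _ _); rewrite Ea /f /=.
  by case: b bs => [[u1|[u1 w1]] q1] //= _ [->]; exists w1, q1.
pose g (v : vtx m) : vtx m.+1 := (inr (u, v.1), v.2).
pose g' (b : vtx m.+1) : vtx m := if b.1 is inr (_, w') then (w', b.2) else (w, b.2).
have gK : map g (map g' (a :: t)) = a :: t.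
  by rewrite -map_comp map_id_in // => b /cl[w' [q' ->]].
exists m, (map g' (a :: t)), q, (map snd t); split=> //; last 1 first.
- split=> // q' /mapP[b bt ->]; apply/negP => sb.
  have [w' [q'' Eb]] : exists w' q', b = (inr (u, w'), q') by apply: cl; rewrite inE bt orbT.
  have ob : @gadj m.+1 (inl u, p) b.
    by rewrite Eb /= eqxx; apply: (attI E ge); move: sb; rewrite Eb.
  case/splitPr: bt ch => t1 t2 ch.
  by have := ch [::] (inl u, p) (a :: t1) b t2 erefl ob.
- apply: (@ipath_map _ _ (@gadj m) (@gadj m.+1) g) => [x y|].
    by case: x y => [x1 x2] [y1 y2]; rewrite /= eqxx.
  by rewrite gK; have [] := @ipath_cat _ _ [:: (inl u, p)] (a :: t) ip.
- rewrite -map_comp; apply/eq_in_map => b /cl[w' [q' ->]] //.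
- by rewrite Ea.
Qed.

(* An induced path climbs from its first vertex to a unit containing its core
   and descends from there: every chain follows gates of increasing level. *)
Lemma ipath_decomp m (s : seq (vtx m)) : ipath (@gadj m) s -> s != [::] ->
  exists A x c B, [/\ map snd s = A ++ (x :: c) ++ B, ipath (@uadj N) (x :: c),
    rside m (last x c) B & rside m x (rev A)].
Proof.
elim: m s => [|m IH] s ip s0.
  case: s s0 ip => [|x s] // _ ip.
  exists [::], x.2, (map snd s), [::]; rewrite cats0; split=> //; try by left.
  by apply: (ipath_same_unit _ ip) => -[[] p] [[] q].
pose O (x : vtx m.+1) := if x.1 is inl _ then true else false.
pose cell (x : vtx m.+1) := if x.1 is inr (u, _) then Some u else None.
have H1 : {in predC O &, forall x y, gadj x y -> cell x = cell y}.
  move=> [[u|[u w]] p] [[u'|[u' w']] q] //= _ _ /andP[/eqP->] //.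
have [|t1 [Q [t2 [E OQ O1 O2 Qt]]]] := @ipath_cells _ _ _ O cell s H1 _ ip.
  (* The two outer neighbours are distinct gates of level [m] in the same unit, hence twins. *)
  move=> [[u|//] p] [[u'|//] q] [[//|[v w]] a] [[//|[v' w']] b] _ _ ne _ _.
  rewrite /cell /= => /andP[/eqP<- /attP[e [E1 g1 _]]] /andP[/eqP<- /attP[e' [E2 g2 _]]] [uu].
  subst u'; rewrite gadj_unit; apply: (gate_adj g1 g2); first by rewrite E1.
  by apply: contraNneq ne => ->.
have inn t : all (predC O) t -> {in t, forall x : vtx m.+1, if x.1 is inr _ then true else false}.
  by move=> /allP h x /h; rewrite /O /=; case: (x.1).
case: Q E OQ Qt => [|o Q] E OQ Qt.
  (* The path lies in one attached copy, where the induction hypothesis applies. *)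
  rewrite Qt // in E; rewrite !cats0 in E; subst t1.
  case: s s0 ip O1 => [|[[u|[u w]] p] s] // _ ip O1.
  have so : sorted (@gadj m.+1) ((inr (u, w), p) :: s) by case: ip.
  pose g (v : vtx m) : vtx m.+1 := (inr (u, v.1), v.2).
  pose g' (b : vtx m.+1) : vtx m := if b.1 is inr (_, w') then (w', b.2) else (w, b.2).
  have K : {in (inr (u, w), p) :: s &, forall x y, cell x = cell y}.
    apply: (@sorted_const _ (@gadj m.+1)) so => x y /(allP O1) hx /(allP O1) hy.
    exact: H1.
  have gK : map g (map g' ((inr (u, w), p) :: s)) = (inr (u, w), p) :: s.
    rewrite -map_comp map_id_in // => b bs.
    have := K _ _ bs (mem_head _ _); rewrite /cell /=.
    by case: b {bs} => [[u1|[u1 w1]] q1] //= [->].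
  have /IH/(_ isT) [A [x [c [B [h1 h2 h3 h4]]]]] :
      ipath (@gadj m) (map g' ((inr (u, w), p) :: s)).
    apply: (@ipath_map _ _ (@gadj m) (@gadj m.+1) g) => [x y|]; last by rewrite gK.
    by case: x y => [x1 x2] [y1 y2]; rewrite /= eqxx.
  exists A, x, c, B; split=> //; try exact: rsideW.
  rewrite -h1 -map_comp; apply/eq_in_map => b bs.
  by rewrite /= /g'; case: (b.1) => // -[].
pose g (v : vtx m) : vtx m.+1 := (inl v.1, v.2).
have [u0 [p0 Eo]] : exists u p, o = (inl u, p).
  by case: o {E Qt} OQ => [[u|?] p] //=; exists u, p.
pose g' (b : vtx m.+1) : vtx m := if b.1 is inl w' then (w', b.2) else (u0, b.2).
have gK : map g (map g' (o :: Q)) = o :: Q.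
  rewrite -map_comp map_id_in // => b /(allP OQ).
  by case: b => [[u1|[u1 w1]] q1].
have ipQ : ipath (@gadj m.+1) (o :: Q) by move: ip; rewrite E; apply: ipath_infix.
have /IH/(_ isT) [A [x [c [B [h1 h2 h3 h4]]]]] : ipath (@gadj m) (map g' (o :: Q)).
  apply: (@ipath_map _ _ (@gadj m) (@gadj m.+1) g) => [x y|]; last by rewrite gK.
  by case: x y => [x1 x2] [y1 y2].
have hQ : map snd (o :: Q) = A ++ (x :: c) ++ B.
  by rewrite -h1 -{1}gK -!map_comp; apply: eq_map => b; rewrite /= /g'.
(* The part in [G_m] keeps its core; each excursion into an attached copy extends a side by a
   descent of level [m]. *)
exists (map snd t1 ++ A), x, c, (B ++ map snd t2); split=> //.
- by rewrite E !map_cat hQ -!catA.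
- apply: rside_ext => //.
  have lQ : O (last o Q) by rewrite (allP OQ) // mem_last.
  have [u Eu] : exists u, (last o Q).1 = inl u.
    by move: lQ; rewrite /O; case: ((last o Q).1) => // u _; exists u.
  have := @ipath_tail m (last o Q) u t2 _ Eu (inn _ O2).
  have -> : (last o Q).2 = last (last x c) B.
    rewrite -(last_map snd) -[last _ _]/(last x (map snd (o :: Q))) hQ.
    by rewrite !last_cat.
  apply; move: ip; rewrite E lastI cat_rcons => h.
  by have := @ipath_infix _ _ (t1 ++ belast o Q) (last o Q :: t2) [::]; rewrite cats0 -catA; apply.
- rewrite rev_cat; apply: rside_ext => //; rewrite -map_rev.
  have := @ipath_tail m o u0 (rev t1) _ _ (inn (rev t1) _).
  have -> : o.2 = last x (rev A).
    have /(congr1 (head x)) := hQ; case: (A) => [|a A'] /= -> //.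
    by rewrite rev_cons last_rcons.
  apply; rewrite ?Eo ?all_rev //.
  have : ipath (@gadj m.+1) (rev (t1 ++ [:: o])).
    apply: ipath_rev; first exact: gadj_sym.
    move: ip; rewrite E -[o :: Q]cat1s -catA catA => h.
    by case: (ipath_cat h).
  by rewrite rev_cat Eo.
Qed.

End Graph.

(** * Counting the slots with small labels *)

Section Counting.
Variable N : nat.
Local Notation nlev := (nlev N).
Local Notation lam := (lam N).
Local Notation exc := (exc N).
Local Notation nbelow := (nbelow N).

Lemma lamE : lam = 2 ^ N.+1.
Proof. by rewrite /lam /nlev expnS mul2n. Qed.

(** Take for [x] the largest multiple of [2^i] up to [c - d], where [d <= 2^i < 2d]. As [2^i]
    divides [gcd(x, lam)], block [x] climbs by [4 * 2^i] or to the largest label, and so reaches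
    [c]. *)
Lemma label_hit c d : 0 < d <= c -> c < lam ->
  exists x, [/\ x + d <= c, c < x + 3 * d & c \in exc x].
Proof.
case/andP=> d0 dc cl.
have [i /andP[i1 i2]] : exists i, d <= 2 ^ i < 2 * d.
  case: (leqP d 1) => d1; first by exists 0; lia.
  exists (up_log 2 d); have /andP[h1 ->] := up_log_bounds (isT : 1 < 2) d1.
  case: (up_log 2 d) h1 => [|k] /=; first by lia.
  by rewrite expnS; lia.
pose x := (c - d) %/ 2 ^ i * 2 ^ i; exists x.
have q0 : 0 < 2 ^ i by rewrite expn_gt0.
have x1 : x <= c - d by apply: leq_trunc_div.
have x2 : c - d < x + 2 ^ i by rewrite /x addnC -mulSn ltn_ceil.
split; [by lia|by lia|rewrite exc_mem].
have dx : 2 ^ i %| gcdn x lam.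
  rewrite dvdn_gcd dvdn_mull //= lamE dvdn_exp2l //.
  rewrite -ltnS -(ltn_exp2l _ _ (isT : 1 < 2)) expnS -lamE; lia.
have : 2 ^ i <= gcdn x lam by apply: dvdn_leq => //; rewrite gcdn_gt0 orbC (leq_ltn_trans _ cl).
by rewrite /hgt; lia.
Qed.

Lemma sum_dvd q a b : 0 < q -> a <= b ->
  q * \sum_(a <= y < b) (q %| y : nat) <= b - a + q.
Proof.
(* [F y] is the number of multiples of [q] below [y]. *)
move=> q0 ab; pose F y := (y + q.-1) %/ q.
have FS y : F y.+1 = F y + (q %| y).
  by rewrite /F addSn divnS // -addnS prednK // dvdn_addl // addnC.
have -> : \sum_(a <= y < b) (q %| y : nat) = F b - F a.
  rewrite -(subnKC ab); elim: (b - a) => [|n IH]; first by rewrite addn0 big_geq // subnn.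
  rewrite addnS big_nat_recr ?leq_addr //= IH FS.
  have : F a <= F (a + n) by rewrite /F leq_div2r // leq_add2r leq_addr.
  by lia.
rewrite mulnBr; have h1 : q * F b <= b + q.-1 by rewrite mulnC leq_trunc_div.
have h2 : a <= q * F a.
  have : a + q.-1 < (F a).+1 * q by rewrite ltn_ceil.
  by rewrite mulSn mulnC; lia.
by lia.
Qed.

(** The gcd is a power of two. The term for its exponent, capped at that of [D], suffices; the
    factor 2 pays for rounding [D] down to a power of two. *)
Lemma min_gcd_le y D : 0 < D ->
  minn (gcdn y lam) D <= 2 * \sum_(i < N.+2) (2 ^ i * ((2 ^ i %| y) && (2 ^ i <= D))).
Proof.
move=> D0; have : gcdn y lam %| 2 ^ N.+1 by rewrite -lamE dvdn_gcdr.
case/(dvdn_pfactor _ _ (isT : prime 2)) => v vN E.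
have dy : 2 ^ v %| y by rewrite -E dvdn_gcdl.
pose i := minn v (trunc_log 2 D).
have iN : i < N.+2 by rewrite ltnS geq_min vN.
have /andP[t1 t2] := trunc_log_bounds (isT : 1 < 2) D0.
rewrite (bigD1 (Ordinal iN)) //= mulnDr; apply: leq_trans (leq_addr _ _).
have -> : 2 ^ i %| y by apply: dvdn_trans dy; rewrite dvdn_exp2l // geq_minl.
have -> : 2 ^ i <= D by apply: leq_trans t1; rewrite leq_exp2l // geq_minr.
rewrite /= muln1 E /i; case: (leqP v (trunc_log 2 D)) => h.
  by rewrite geq_min; apply/orP; left; lia.
by rewrite geq_min; apply/orP; right; move: t2; rewrite expnS; lia.
Qed.

(** Each of the [N+2] exponents contributes at most [2D]: nothing if [2^i > D], and otherwise at
    most [D / 2^i + 1] multiples of weight [2^i]. *)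
Lemma sum_min_gcd a D : 0 < D ->
  \sum_(a <= y < a + D) minn (gcdn y lam) D <= 4 * (N.+2 * D).
Proof.
move=> D0.
apply: (@leq_trans (\sum_(a <= y < a + D)
    2 * \sum_(i < N.+2) (2 ^ i * ((2 ^ i %| y) && (2 ^ i <= D))))).
  by apply: leq_sum => y _; apply: min_gcd_le.
rewrite -big_distrr /= exchange_big /= (_ : 4 = 2 * 2) // -mulnA leq_mul2l /=.
rewrite mulnCA -[N.+2 in X in _ <= X]card_ord -sum_nat_const; apply: leq_sum => i _.
case: (leqP (2 ^ i) D) => h; last first.
  by rewrite big1 // => y _; rewrite andbF muln0.
under eq_bigr do rewrite andbT.
rewrite -big_distrr /=; apply: leq_trans (sum_dvd _ (leq_addr _ _)) _.
  by rewrite expn_gt0.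
by rewrite addKn; lia.
Qed.

(** Slots per label: [8 * 4 * (N+2)] from the gcd sum and 2 from the successor in [hgt], rounded
    up. *)
Definition Lg := 33 * N.+2.

Lemma nbelow_ge c y : c <= y -> nbelow c y = 0.
Proof. by move=> h; apply/eqP; rewrite -leqn0; have := nbelow_le N c y; lia. Qed.

(** The central count. Blocks from [c] on contribute nothing; an earlier block [y >= a] contributes
    at most [8 min(gcd(y, lam), c - a) + 2]. *)
Lemma sum_nbelow a b c : a <= c -> \sum_(a <= y < b) nbelow c y <= Lg * (c - a).
Proof.
move=> ac; case: (posnP (c - a)) => [D0|D0].
  rewrite big_nat big1 // => y /andP[h _]; apply: nbelow_ge; lia.
apply: (@leq_trans (\sum_(a <= y < c) nbelow c y)).
  case: (leqP b c) => bc; last first.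
    rewrite (@big_cat_nat _ _ _ c) //=; last exact: ltnW.
    rewrite [X in _ + X]big_nat [X in _ + X]big1 ?addn0 // => y /andP[h _].
    exact: nbelow_ge.
  case: (leqP a b) => ab; last by rewrite big_geq // ltnW.
  by rewrite (@big_cat_nat _ _ _ b a c) //= leq_addr.
apply: (@leq_trans (\sum_(a <= y < a + (c - a)) (8 * minn (gcdn y lam) (c - a) + 2))).
  rewrite subnKC // big_nat [X in _ <= X]big_nat.
  apply: leq_sum => y /andP[h1 h2]; have := nbelow_le N c y; rewrite /hgt; lia.
rewrite big_split /= -big_distrr /= sum_nat_const_nat addKn.
have := sum_min_gcd a D0; rewrite /Lg; set X := \sum_(_ <= _ < _) _; nia.
Qed.

Lemma lab_lt i : i < st N lam -> lab N i < lam.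
Proof. by case/block_of=> y yl /(lab_mem yl); rewrite exc_mem /hgt; lia. Qed.

Lemma maxlen_le : maxlen N <= (Lg * lam).+1.
Proof.
rewrite ltnS; have := @sum_nbelow 0 lam lam (leq0n _).
have e0 : st N 0 = 0 by [].
rewrite -count_lab ?leqnn // e0 !subn0.
by rewrite (eq_in_count (a2 := predT)) ?count_predT ?size_iota // => i; rewrite mem_iota => /lab_lt.
Qed.

End Counting.

(** * Bounding the induced paths *)

Section Bound.
Variable N : nat.
Local Notation nlev := (nlev N).
Local Notation lam := (lam N).
Local Notation exc := (exc N).
Local Notation nbelow := (nbelow N).
Local Notation pos := (pos N).
Local Notation uadj := (@uadj N).
Local Notation maxlen := (maxlen N).
Local Notation Lg := (Lg N).

Definition cum c n := \sum_(0 <= y < n) nbelow c y.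

Lemma cumB c a b : a <= b -> \sum_(a <= y < b) nbelow c y = cum c b - cum c a.
Proof. by move=> ab; rewrite /cum (@big_cat_nat _ _ _ a 0 b) //= addKn. Qed.

Lemma cum_mono c a b : a <= b -> cum c a <= cum c b.
Proof. by move=> ab; rewrite /cum (@big_cat_nat _ _ _ a 0 b) //= leq_addr. Qed.

Lemma cum_diff c a b : a <= c -> cum c b <= cum c a + Lg * (c - a).
Proof.
move=> ac; case: (leqP a b) => ab.
  by rewrite -leq_subLR -cumB // sum_nbelow.
by apply: leq_trans (leq_addr _ _); apply/cum_mono/ltnW.
Qed.

Lemma cum_le c b : c <= lam -> cum c b <= Lg * lam.
Proof.
move=> cl; have := @cum_diff c 0 b (leq0n _); rewrite {2}/cum big_geq // add0n subn0.
by move/leq_trans; apply; rewrite leq_mul2l cl orbT.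
Qed.

(** Having no [e]-slot after its entry, the tail stays on one side of the value [e]. On the upper
    side it cannot leave its unit; on the lower side it starts right under its entry, the situation
    treated by [low_bound]. *)
Lemma tailP e (R : seq pos) : tail e R -> exists x R',
  [/\ R = x :: R', isslot e x, {in R', forall q, ~~ isslot e q}, e < lam &
    (ipath uadj R /\ {in R', forall q, e <= mu q}) \/
    exists r : seq (vtx N e./2), [/\ ipath (@gadj N e./2) r, map snd r = R',
      {in R', forall q, mu q < e} & forall h t, R' = h :: t -> e <= (mu h).+1]].
Proof.
case=> m [r [x [R' [Em ip Er ER [sx H]]]]]; subst m.
have el := isslot_lt sx; exists x, R'; split=> //; rewrite {}ER in Er *.
case: r Er ip => [|[t p] r] //= [Ep Er] ip; subst p.
case: r Er ip => [|[t1 p1] r] Er ip; subst R'.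
  left; split=> //; split=> // s1 a s2 b s3 /(congr1 size).
  by rewrite size_cat /= size_cat /=; lia.
have [us so ch] := ip.
have [Et u1] : t = t1 /\ uadj x p1.
  by case/andP: so => h _; apply: (@gadj_slot _ _ e _ _ (leqnn _) _ h).
have so' : sorted (@gadj N e./2) ((t1, p1) :: r) by case/andP: so.
have sep : {in (t1, p1) :: r &, forall y z, (mu y.2 < e) = (mu z.2 < e)}.
  by apply: (gadj_sep (leqnn _) el so') => y ys; apply: H; apply: map_f.
have [low|high] := boolP (mu p1 < e).
  right; exists ((t1, p1) :: r); split=> //.
  - by have [] := @ipath_cat _ _ [:: (t, x)] ((t1, p1) :: r) ip.
  - by move=> q /mapP[y ys ->]; rewrite (sep y (t1, p1)) ?mem_head.
  - by move=> h tl [<- _]; have := uadj_lip u1; rewrite (isslot_mu sx) /lip; lia.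
have hi : {in (t1, p1) :: r, forall y, e <= mu y.2}.
  by move=> y ys; rewrite leqNgt (sep y (t1, p1)) ?mem_head.
left; split; last by move=> q /mapP[y ys ->]; apply: hi.
apply: (@ipath_same_unit _ _ ((t, x) :: (t1, p1) :: r)) ip.
suff [] : {in (t, x) :: (t1, p1) :: r &, forall y z, y.1 = z.1} /\
    sorted uadj (map snd ((t, x) :: (t1, p1) :: r)) by [].
apply: same_unit => // y z ys _ yz.
move: ys; rewrite inE => /orP[/eqP Ey|/hi he].
  by apply: (@gadj_slot _ _ e _ _ (leqnn _) _ yz); rewrite Ey.
exact: (gadj_low (leqnn _) yz he).
Qed.

(** A completed descent ends at a gate of higher level, whose value exceeds [e']; this excludes the
    lower side in [tailP]. *)
Lemma tail_link e' R e (z : pos) : tail e' R -> e'./2 < e./2 -> isgate e (last z R) ->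
  exists x R', [/\ R = x :: R', isslot e' x, {in R', forall q, ~~ isslot e' q},
    isgate e (last x R') & uniq R /\ sorted uadj R].
Proof.
case/tailP=> x [R' [ER sx H el]]; subst R => /= h ee gl; exists x, R'; split=> //.
case: h => [[[us so _] _]|[r [_ _ low _]]] //.
case: R' gl low {H} => [|h R'] gl low.
  by have := isgate_not_slot e' gl; rewrite /= sx.
by have := low _ (mem_last h R'); rewrite (isgate_mu gl); lia.
Qed.

Lemma chain_start (z : pos) e B : chain z e B -> exists2 e0, isgate e0 z & e0./2 <= e./2.
Proof.
elim=> [e0 g|e' e1 B1 R _ [e0 g h] le _ _]; first by exists e0.
by exists e0; last exact: leq_trans h (ltnW le).
Qed.

Lemma gate_label e e' (z : pos) : isgate e z -> isgate e' z -> e = e'.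
Proof. by case: z => [|[[j b] i]] //= /andP[_ /eqP->] /andP[_ /eqP->]. Qed.

(** Telescoping with the potential [2 cum(2m) + 2 cum(2m+2)] at level [m]: two terms, as the zones
    of successive links may overlap within the blocks of one level. *)
Lemma chain_bound c (z : pos) e B e0 : chain z e B -> isgate e0 z ->
  {in B, forall q l, isslot l q -> l < c} ->
  size B + 4 * cum c e0./2.*2 <=
    2 * cum c e./2.*2 + 2 * cum c e./2.*2.+2 + 3 * (e./2 - e0./2).
Proof.
move=> ch g0; elim: ch => [e1 g1|e' e1 B1 R ch IH le tl gl] Hc.
  rewrite (gate_label g0 g1) /=.
  have := @cum_mono c e1./2.*2 e1./2.*2.+2; lia.
have [x [R' [ER sx H gl' [us so]]]] := tail_link tl le gl.
rewrite size_cat.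
have h1 : size B1 + 4 * cum c e0./2.*2 <=
    2 * cum c e'./2.*2 + 2 * cum c e'./2.*2.+2 + 3 * (e'./2 - e0./2).
  by apply: IH => q qs; apply: Hc; rewrite mem_cat qs.
have [e2 g2 le2] := chain_start ch; rewrite -(gate_label g0 g2) in le2.
have := @link_bound N x R' e' e1 c; rewrite -ER => /(_ us so sx H gl').
have -> : e' <= e1./2.*2.+1 by lia.
move=> /(_ isT) h2.
have {}h2 : size R <= (\sum_(e'.+1 <= y < e1./2.*2.+2) nbelow c y).*2 + 3.
  by apply: h2 => q qs; apply: Hc; rewrite mem_cat qs orbT.
rewrite cumB in h2; last by lia.
have m1 : cum c e'./2.*2 <= cum c e'.+1 by apply: cum_mono; lia.
have m2 : cum c e'./2.*2.+2 <= cum c e1./2.*2 by apply: cum_mono; lia.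
have m3 : cum c e'.+1 <= cum c e1./2.*2.+2 by apply: cum_mono; lia.
by lia.
Qed.

(** By [link_cover], the links together climb every block between the first and the last gate. *)
Lemma chain_cover (z : pos) e B e0 y l : chain z e B -> isgate e0 z ->
  e0./2.*2.+1 < y <= e./2.*2.+1 -> l \in exc y -> exists2 q, q \in B & isslot l q.
Proof.
move=> ch g0; elim: ch => [e1 g1|e' e1 B1 R ch IH le tl gl] /andP[h1 h2] ly.
  by rewrite (gate_label g0 g1) in h1; lia.
case: (leqP y e'./2.*2.+1) => h.
  by have [|q qs sq] := IH _ ly; [rewrite h1|exists q; rewrite // mem_cat qs].
have [x [R' [ER sx H gl' [us so]]]] := tail_link tl le gl.
rewrite ER in so; have [|q qs sq] := link_cover so sx H gl' _ ly; first by lia.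
by exists q; rewrite // mem_cat ER qs orbT.
Qed.

(** In [low_bound] the core, the end chain and the start side cost 2, 4 and 6 times [Lg * (c - a)],
    and [c - a <= 3 * d]: hence 36. The other terms fit into 47, as [d >= 1]. *)
Definition kap := 36 * Lg + 47.
Definition tau := 8 * maxlen + 4 * (Lg * lam) + 3 * nlev + 1.

(* The final tail of the start side: being chained to the first vertex, whose
   label is at least c - 1, it cannot lie below its own label. *)
Lemma start_tail c e (A1 RA : seq pos) h t : 0 < c -> e./2 < c./2 -> tail e RA ->
  rev (h :: t) = A1 ++ RA -> c <= (mu h).+1 -> {in h :: t, forall q, mu q < c} -> c <= lam ->
  [/\ size RA <= maxlen.*2 &
      size RA <= (\sum_(e.+1 <= y < lam) nbelow c y).*2 + 8 * (c - e) + 2].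
Proof.
move=> c0 ec /tailP[x [R' [ER sx H el h0]]] E hh low cl.
have lowR : {in RA, forall q, mu q < c}.
  by move=> q qs; apply: low; rewrite -mem_rev E mem_cat qs orbT.
have lastE : h = last x R'.
  have /(congr1 (last x)) := E; rewrite rev_cons last_rcons ER last_cat => -> //.
have [[[us so _] hi]|[r [_ _ lo _]]] := h0.
  have hi' : {in RA, forall q, e <= mu q}.
    by move=> q; rewrite ER inE => /orP[/eqP->|/hi//]; rewrite (isslot_mu sx).
  split; last by apply: high_bound => //; rewrite ER.
  by apply: size_mount => //; apply: low_mount lowR.
case: R' ER lastE lo {H h0} => [|y R'] ER lastE lo.
  by rewrite ER /=; split; [rewrite /maxlen; lia|lia].
by have := lo _ (mem_last y R'); rewrite -[last y R']/(last x (y :: R')) -lastE; lia.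
Qed.

(* Induction on c: with d the drop from c to the label c' of the last descent, the
   core and both chains cost at most kap * d. *)
Lemma low_bound c (s : seq (vtx N c./2)) : c < lam -> ipath (@gadj N c./2) s ->
  {in s, forall x, mu x.2 < c} ->
  (forall h t, map snd s = h :: t -> c <= (mu h).+1) ->
  size s <= kap * c + tau.
Proof.
elim/ltn_ind: c s => c IH s cl ip low hd.
case: (eqVneq s [::]) => [->//|s0].
have [A [x [co [B [E ipc rB rA]]]]] := ipath_decomp ip s0.
have lowP : {in map snd s, forall q, mu q < c} by move=> q /mapP[y ys ->]; apply: low.
have lowc : {in x :: co, forall q, mu q < c}.
  by move=> q qs; apply: lowP; rewrite E !mem_cat qs ?orbT.
have lowB : {in B, forall q, mu q < c}.
  by move=> q qs; apply: lowP; rewrite E !mem_cat qs ?orbT.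
have lowA : {in A, forall q, mu q < c}.
  by move=> q qs; apply: lowP; rewrite E !mem_cat qs ?orbT.
have cl' := ltnW cl; have c0 : 0 < c by have := lowc x (mem_head _ _); lia.
have [uc soc _] := ipc; have mc := low_mount cl' lowc.
have szc : size (x :: co) <= maxlen.*2 by apply: size_mount.
have -> : size s = size A + size (x :: co) + size B.
  by rewrite -(size_map snd) E !size_cat addnA.
have slotc (q : pos) l : mu q < c -> isslot l q -> l < c.
  by move=> h /isslot_mu E1; rewrite -E1.
have Aside : A = [::] \/ exists e A1 RA, [/\ e./2 < c./2, chain x e A1, rev A = A1 ++ RA,
    size RA <= maxlen.*2 &
    size RA <= (\sum_(e.+1 <= y < lam) nbelow c y).*2 + 8 * (c - e) + 2].
  case: rA => [/(congr1 rev)|[e [A1 [RA [h1 h2 h3 h4]]]]]; first by rewrite revK; left.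
  right; exists e, A1, RA; case: A E lowA h4 => [|h t] E lowA h4.
    case/tailP: h3 => y [R' [ER _]]; move: h4; rewrite ER.
    by move/(congr1 size); rewrite size_cat /= addnS.
  by have [] := start_tail c0 h1 h3 h4 (hd _ _ E) lowA cl'; split.
have mle := cum_le _ cl'.
(* Without an end side there is nothing to recurse on, and [tau] covers the whole path. *)
case: rB => [B0|[c' [B1 [R [h1 h2 h3 h4]]]]].
  rewrite B0 addn0; case: Aside => [->|[e [A1 [RA [g1 g2 g3 g4 _]]]]].
    by rewrite add0n /tau; lia.
  have [e0 ge0 _] := chain_start g2.
  have := congr1 size g3; rewrite size_rev size_cat => ->.
  have : size A1 + 4 * cum c e0./2.*2 <= 2 * cum c e./2.*2 + 2 * cum c e./2.*2.+2 + 3 * (e./2 - e0./2).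
    apply: (chain_bound g2 ge0) => q qs l; apply: slotc; apply: lowA.
    by rewrite -mem_rev g3 mem_cat qs.
  have := mle e./2.*2; have := mle e./2.*2.+2; rewrite /tau.
  have : e./2 <= nlev by move: cl g1; rewrite /lam; lia.
  by lia.
set d := c - c'.
have c'c : c' < c by lia.
(* Block [xs] contains [c], with [xs] above [c - 3d] and at most [c - d = c']. *)
have [||xs [x1 x2 x3]] := @label_hit N c d; [by rewrite /d; lia|by []|].
have [e0 ge0 le0] := chain_start h2.
(* Otherwise the end chain would climb block [xs] and meet a [c]-slot, although the whole path stays
   below [c]. *)
have xe0 : xs <= e0./2.*2.+1.
  rewrite leqNgt; apply/negP => hx.
  have [|q qs sq] := chain_cover h2 ge0 _ x3; first by rewrite hx; move: x1; rewrite /d; lia.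
  by have := lowB q; rewrite h4 mem_cat qs => /(_ isT); rewrite (isslot_mu sq) ltnn.
have noc : {in x :: co, forall q, ~~ isslot c q}.
  by move=> q /lowc h; apply/negP => /isslot_mu E1; rewrite E1 ltnn in h.
have [j [jE zn]] := zone_hit soc mc noc (mem_last x co) ge0 x3 xe0.
(* One less than [xs], since [xs] may equal the odd gate label of its level; [a] is then at most the
   even one. *)
have jl := lev_lam j; pose a := xs.-1.
have ac : a <= c by rewrite /a; lia.
have aj : a <= e0./2.*2 by rewrite /a; lia.
have ca : c - a <= 3 * d by rewrite /a; lia.
have szc2 : size (x :: co) <= (\sum_(xs <= y < j.*2.+2) nbelow c y).*2.+2.
  apply: size_zone => //; first by rewrite -jE; lia.
  by move=> q /lowc h l; apply: slotc.
rewrite cumB in szc2; last by rewrite -jE; lia.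
have ma : cum c a <= cum c xs by apply: cum_mono; rewrite /a; lia.
have maj : cum c a <= cum c e0./2.*2 by apply: cum_mono.
have top n := cum_diff n ac.
have szB1 : size B1 + 4 * cum c e0./2.*2 <=
    2 * cum c c'./2.*2 + 2 * cum c c'./2.*2.+2 + 3 * (c'./2 - e0./2).
  apply: chain_bound h2 ge0 _ => q qs l; apply: slotc; apply: lowB.
  by rewrite h4 mem_cat qs.
(* The last descent stays in a single mountain or, after its first slot, falls under the induction
   hypothesis for [c']. *)
have szR : size R <= 1 + (kap * c' + tau).
  have [y [R' [ER sx H el [[[us so _] _]|[r [ipr Er lo hr]]]]]] := tailP h3.
    have : size R <= maxlen.*2; last by rewrite /tau; lia.
    apply: size_mount => //; apply: (low_mount cl') => q qs; apply: lowB.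
    by rewrite h4 mem_cat qs orbT.
  rewrite ER /= add1n ltnS -Er size_map; apply: IH => //.
    by move=> z zs; apply: lo; rewrite -Er; apply: map_f.
  by move=> h t; rewrite Er => /hr.
(* The core lies in mountain [j], so the start chain, if any, begins at a gate of the same
   mountain. *)
have szA : size A <= 6 * (Lg * (c - a)) + 11 * (c - a) + 2.
  case: Aside => [->//|[e [A1 [RA [g1 g2 g3 _ g5]]]]].
  have [e1 ge1 le1] := chain_start g2.
  have e1j : e1./2 = j.
    have [b [i [Ex _ _]]] := zn x (mem_head _ _).
    move: ge1; rewrite Ex /= => /andP[_ /eqP->]; case: (b) => /=; lia.
  have hb : size A1 + 4 * cum c e1./2.*2 <= 2 * cum c e./2.*2 + 2 * cum c e./2.*2.+2 + 3 * (e./2 - e1./2).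
    apply: chain_bound g2 ge1 _ => q qs l; apply: slotc; apply: lowA.
    by rewrite -mem_rev g3 mem_cat qs.
  have := congr1 size g3; rewrite size_rev size_cat => ->.
  have ee : e.+1 <= lam by lia.
  rewrite cumB // in g5.
  have := top e./2.*2; have := top e./2.*2.+2; have := top lam.
  have : cum c a <= cum c e.+1 by apply: cum_mono; lia.
  by rewrite e1j -jE in hb le1; lia.
have szB : size B = size B1 + size R by rewrite h4 size_cat.
have t1 := top c'./2.*2; have t2 := top c'./2.*2.+2; have t3 := top j.*2.+2.
have kE : kap * c = kap * d + kap * c' by rewrite -mulnDr /d subnK // ltnW.
have kd : kap * d = 36 * (Lg * d) + 47 * d by rewrite /kap mulnDl mulnA.
have Ld : Lg * (c - a) <= 3 * (Lg * d) by rewrite mulnCA leq_mul2l ca orbT.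
by rewrite kE kd szB; lia.
Qed.

Definition ibound := 3 * (maxlen.*2.*2 + nlev.+1) + 2 * (4 * (Lg * lam) + 3 * nlev + 1 + kap * lam + tau).

Lemma rside_bound m (z : pos) B : rside m z B ->
  size B <= (maxlen.*2.*2 + nlev.+1) + (4 * (Lg * lam) + 3 * nlev + 1 + kap * lam + tau).
Proof.
case=> [->//|[e [B1 [R [h1 h2 h3 ->]]]]].
have [e0 g0 le0] := chain_start h2.
have hb := chain_bound h2 g0 (c := lam) (fun q _ l => @isslot_lt N l q).
have c1 := cum_le e./2.*2 (leqnn lam); have c2 := cum_le e./2.*2.+2 (leqnn lam).
have [y [R' [ER sx H el hR]]] := tailP h3.
have el2 : e./2 <= nlev by move: el; rewrite /lam; lia.
have szR : size R <= (maxlen.*2.*2 + nlev.+1) + (1 + kap * lam + tau).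
  case: hR => [[ip _]|[r [ipr Er lo hr]]].
    by apply: leq_trans (size_ipath_unit ip) _; lia.
  have : size r <= kap * e + tau.
    apply: low_bound => //; first by move=> z' zs; apply: lo; rewrite -Er; apply: map_f.
    by move=> h t; rewrite Er => /hr.
  have : kap * e <= kap * lam by rewrite leq_mul2l ltnW // orbT.
  by rewrite ER /= -Er size_map => k1 k2; apply: leq_ltn_trans k2 _; lia.
by rewrite size_cat; lia.
Qed.

Lemma ipath_bound m (s : seq (vtx N m)) : ipath (@gadj N m) s -> size s <= ibound.
Proof.
case: (eqVneq s [::]) => [->//|s0] ip.
have [A [x [co [B [E ipc rB rA]]]]] := ipath_decomp ip s0.
have := rside_bound rB; have := rside_bound rA; have := size_ipath_unit ipc.
rewrite -(size_map snd) E !size_cat size_rev /ibound.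
by move: (size A) (size (x :: co)) (size B) => a b c; lia.
Qed.

End Bound.

(** * Construction of a long path *)

Section LongPath.
Variable N : nat.
Local Notation nlev := (nlev N).
Local Notation lam := (lam N).
Local Notation pos := (pos N).
Local Notation uadj := (@uadj N).
Local Notation maxlen := (maxlen N).
Local Notation len := (len N).
Local Notation vtx := (vtx N).

(* [gstep m] is adjacency, except that a gate labelled 2j with j >= m may only be
   left towards its twin: this is where later levels insert their detours. *)
Definition evengate m (p : pos) :=
  if p is inr (j, b, i) then [&& m <= j, ~~ b & i == len j :> nat] else false.

Definition partner (p q : pos) :=
  if p is inr (j, _, _) then q == inr (j, true, inord (len j)) else false.

Definition ustep : rel pos := fun p q => uadj p q && (evengate 0 p ==> partner p q).

Definition gstep m : rel (vtx m) := fun x y =>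
  gadj x y && (evengate m x.2 ==> (y.1 == x.1) && partner x.2 y.2).

Lemma path_iota_map (T : Type) (r : rel T) (f : nat -> T) a n :
  (forall i, a <= i < a + n -> r (f i) (f i.+1)) -> path r (f a) (map f (iota a.+1 n)).
Proof.
elim: n a => //= n IH a H; rewrite H ?IH //; last by lia.
by move=> i hi; apply: H; lia.
Qed.

Lemma path_rev_map (T : Type) (r : rel T) (f : nat -> T) a n :
  (forall i, a <= i < a + n -> r (f i.+1) (f i)) -> path r (f (a + n)) (map f (rev (iota a n))).
Proof.
elim: n => [|n IH] H //=; rewrite -/(iota a n.+1) -[n.+1]addn1 iotaD rev_cat map_cat /= addnA addn1 H; last by lia.
by rewrite /= IH // => i hi; apply: H; lia.
Qed.

Definition lp (j : 'I_nlev) b i : pos := inr (j, b, inord i).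

Lemma lpK (j : 'I_nlev) i : i <= len j -> (inord i : 'I_maxlen) = i :> nat.
Proof. by move=> h; rewrite inordK // ltnS; apply: leq_trans h (len_le _). Qed.

Definition rho (p : pos) :=
  match p with
  | inl v => (v * maxlen.*2.+2).-1
  | inr (j, b, i) => j * (maxlen.*2.+2) + (if b then maxlen.*2 - i else i)
  end.

(* [rho] increases along the path, which is therefore duplicate-free. *)
Definition uforward : rel pos := fun p q => ustep p q && (rho p < rho q).

Lemma uforward_up (j : 'I_nlev) i : i < len j -> uforward (lp j false i) (lp j false i.+1).
Proof.
move=> h; rewrite /uforward /ustep /lp /= !(@lpK j) ?eqxx ?(ltnW h) //= /nat_step.
by rewrite [i == len j]ltn_eqF //=; lia.
Qed.

Lemma uforward_down (j : 'I_nlev) i : i < len j -> uforward (lp j true i.+1) (lp j true i).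
Proof.
move=> h; rewrite /uforward /ustep /lp /= !(@lpK j) ?eqxx ?(ltnW h) //= /nat_step.
by have := len_lt_max j; lia.
Qed.

Lemma uforward_gate (j : 'I_nlev) : uforward (lp j false (len j)) (lp j true (len j)).
Proof.
rewrite /uforward /ustep /lp /= !(@lpK j) // !eqxx /=; have := len_lt_max j; lia.
Qed.

Lemma uforward_out (j : 'I_nlev) : uforward (lp j true 0) (inl (inord j.+1)).
Proof.
have r : rho (lp j true 0) < rho (inl (inord j.+1)).
  rewrite /lp /rho (@lpK j) // [nat_of_ord (inord j.+1)]inordK; first lia.
  by rewrite ltnS.
rewrite /uforward r andbT /ustep /lp /= (@lpK j) //.
by rewrite [nat_of_ord (inord j.+1)]inordK ?ltnS // addn1 !eqxx.
Qed.

Lemma uforward_in (j : 'I_nlev) : 0 < j -> uforward (inl (inord j)) (lp j false 0).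
Proof.
move=> j0; have K : (inord j : 'I_nlev.+1) = j :> nat by rewrite inordK // ltnW // ltnS.
have r : rho (inl (inord j)) < rho (lp j false 0).
  rewrite /lp /rho (@lpK j) // K; have : 0 < j * maxlen.*2.+2 by rewrite muln_gt0 j0.
  by lia.
by rewrite /uforward r andbT /ustep /lp /= (@lpK j) // K addn0 !eqxx.
Qed.

Lemma lp_slot (j : 'I_nlev) b e : e < lam -> isslot e (lp j b (lam - e.+1)).
Proof.
move=> el; have l1 : lam <= len j by rewrite -(st1 N) st_mono.
rewrite /lp /= (@lpK j); last by lia.
by rewrite lab_first; lia.
Qed.

Lemma upath_mount (j : 'I_nlev) i0 i1 : i0 <= len j -> i1 <= len j ->
  exists h, [/\ path uforward (lp j false i0) h, last (lp j false i0) h = lp j true i1 &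
    forall b, lp j b (len j) \in lp j false i0 :: h].
Proof.
move=> h0 h1; pose u := map (lp j false) (iota i0.+1 (len j - i0)).
have lst : last (lp j false i0) u = lp j false (len j).
  rewrite last_map; case E: (len j - i0) => [|n]; first by rewrite /=; congr lp; lia.
  by rewrite last_iota //; congr lp; lia.
have e1 : lp j true (len j) = lp j true (i1 + (len j - i1)) by rewrite subnKC.
exists (u ++ lp j true (len j) :: map (lp j true) (rev (iota i1 (len j - i1)))); split.
- rewrite cat_path lst /= uforward_gate e1 path_rev_map ?andbT => [|i hi]; last by apply: uforward_down; lia.
  by apply: path_iota_map => i hi; apply: uforward_up; lia.
- rewrite last_cat /= last_map; case E: (len j - i1) => [|n]; first by rewrite /=; congr lp; lia.
  by rewrite last_rev_iota.
- case; first by rewrite inE mem_cat mem_head !orbT.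
  by rewrite -cat_cons mem_cat -lst mem_last.
Qed.

(** The path crosses the mountains from left to right, through both gates of each. Its ends are
    taken in the first block, where every label occurs. *)
Lemma upath_exists k n : k < nlev -> n < nlev -> exists x h,
  [/\ isslot k.*2 x, path uforward x h,
      exists2 j : 'I_nlev, last x h = lp j true (lam - k.*2.+2) & j = n :> nat
    & forall j : 'I_nlev, j <= n -> forall b, lp j b (len j) \in x :: h].
Proof.
move=> kn; have kl : k.*2.+2 <= lam by rewrite /lam; lia.
have ll (j : 'I_nlev) : lam <= len j by rewrite -(st1 N) st_mono.
have i1l (j : 'I_nlev) : lam - k.*2.+2 <= len j by have := ll j; lia.
elim: n => [|n IH] nn.
  pose j := Ordinal nn; have i0l : lam - k.*2.+1 <= len j by have := ll j; lia.
  have [h [h1 h2 h3]] := upath_mount i0l (i1l j).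
  exists (lp j false (lam - k.*2.+1)), h; split=> //; first by apply: lp_slot; lia.
    by exists j.
  by move=> j' hj b; have -> // : j' = j by apply: val_inj => /=; lia.
have [x [h [h1 h2 [j lj jn] h3]]] := IH (ltnW nn).
pose j' := Ordinal nn; have [h' [g1 g2 g3]] := upath_mount (leq0n (len j')) (i1l j').
have jj : inl (inord j.+1) = inl (inord j') :> pos by rewrite jn.
exists x, (h ++ map (lp j true) (rev (iota 0 (lam - k.*2.+2))) ++
  inl (inord j') :: lp j' false 0 :: h'); split=> //.
- rewrite cat_path h2 lj cat_path /=.
  rewrite -[lam - k.*2.+2 in X in path _ (lp _ _ X)]add0n path_rev_map => [|i hi]; last first.
    by apply: uforward_down; have := i1l j; lia.
  rewrite -jj; have -> : last (lp j true (lam - k.*2.+2)) (map (lp j true) (rev (iota 0 (lam - k.*2.+2)))) = lp j true 0.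
    rewrite last_map; case E: (lam - k.*2.+2) => [|i] //=.
    by rewrite -/(iota 0 i.+1) last_rev_iota.
  by rewrite uforward_out jj uforward_in.
- by exists j' => //; rewrite !last_cat.
- move=> i; rewrite leq_eqVlt => /orP[/eqP E b|hi b].
    have -> : i = j' by apply: val_inj.
    by rewrite -cat_cons !mem_cat [_ \in inl _ :: _]in_cons g3 !orbT.
  by rewrite -cat_cons mem_cat h3.
Qed.

Lemma isgate_lp e : e < lam -> exists j : 'I_nlev, isgate e (lp j (odd e) (len j)).
Proof.
move=> el; have h : e./2 < nlev by move: el; rewrite /lam; lia.
by exists (Ordinal h); rewrite /lp /= (@lpK (Ordinal h)) // eqxx /=; lia.
Qed.

Lemma upath k : k < nlev -> exists x h,
  [/\ isslot k.*2 x, isslot k.*2.+1 (last x h), path ustep x h, uniq (x :: h)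
    & forall e, e < lam -> has (isgate e) (x :: h)].
Proof.
move=> kn; have n0 : nlev.-1 < nlev by have := nlev_gt0 N; lia.
have [x [h [h1 h2 [j lj jn] h3]]] := upath_exists kn n0.
exists x, h; split=> //.
- by rewrite lj; apply: lp_slot; rewrite /lam; lia.
- by apply: sub_path h2 => p q /andP[].
- apply: (@map_uniq _ _ rho); apply: (@sorted_uniq _ ltn) => //.
  + exact: ltn_trans.
  + exact: ltnn.
  by rewrite sorted_map; apply: sub_path h2 => p q /andP[].
- move=> e /isgate_lp[i hi]; apply/hasP; exists (lp i (odd e) (len i)) => //.
  by apply: h3; have := ltn_ord i; lia.
Qed.

Definition vout m (v : vtx m) : vtx m.+1 := (inl v.1, v.2).
Definition vin m (u : node m) (v : vtx m) : vtx m.+1 := (inr (u, v.1), v.2).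

Section Splice.
Variables (m : nat) (x' : vtx m) (w' : seq (vtx m)).

Definition isg (v : vtx m) := isgate m.*2 v.2.

Definition blk (v : vtx m) : seq (vtx m.+1) :=
  vout v :: (if isg v then map (vin v.1) (x' :: w') else [::]).

Definition splice (w : seq (vtx m)) := flatten (map blk w).

Lemma count_splice (P : pred pos) w :
  count (fun v => P v.2) (splice w) =
  count (fun v => P v.2) w + count isg w * count (fun v => P v.2) (x' :: w').
Proof.
elim: w => //= v w IH; rewrite -/(splice w) count_cat IH mulnDl.
case: (isg v); rewrite /= ?mul1n ?mul0n; last by lia.
by rewrite count_map [count (preim _ _) _](eq_count (a2 := fun v => P v.2)) //; lia.
Qed.

Lemma mem_splice w y : y \in splice w ->
  (exists2 v, v \in w & y = vout v) \/
  (exists2 v, v \in w & isg v /\ exists a, a \in x' :: w' /\ y = vin v.1 a).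
Proof.
case/flattenP=> b /mapP[v vw ->]; rewrite inE => /orP[/eqP->|]; first by left; exists v.
case: ifP => // g /mapP[a aw ->]; right; exists v => //; split=> //; by exists a.
Qed.

(** Detours are disjoint because they use private copies: a unit has a single gate labelled [2m], so
    no copy is visited twice. *)
Lemma uniq_splice w : uniq (x' :: w') -> uniq w -> uniq (splice w).
Proof.
move=> u'; elim: w => //= v w IH /andP[vw uw]; rewrite -/(splice w).
rewrite mem_cat cat_uniq IH // andbT negb_or -!andbA; apply/and4P; split.
- by case: ifP => // _; apply/mapP => -[a _].
- by apply/negP => /mem_splice[[v1 h [E1 E2]]|[v1 _ [_ [a [_ //]]]]];
    move: vw; rewrite [v]surjective_pairing E1 E2 -surjective_pairing h.
- by case: ifP => // _; rewrite -[X in uniq X]/(map (vin v.1) (x' :: w')) map_inj_uniq // => -[a b] [c d] [-> ->].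
- apply/hasPn => y /mem_splice[[v1 h ->]|[v1 h [g1 [a [_ ->]]]]].
    by case: ifP => // _; apply/mapP => -[].
  case: ifP => // g; apply/negP; rewrite -[_ :: _]/(map (vin v.1) (x' :: w')) => /(@mapP _ _ (vin v.1))[b _ [E _]]; case/negP: vw.
  suff -> : v = v1 by [].
  by rewrite [v]surjective_pairing [v1]surjective_pairing E (gate_inj g g1).
Qed.

Lemma gate_even v : isg v -> evengate m v.2.
Proof.
rewrite /isg; case: v => t [|[[j b] i]] //= /andP[-> /eqP E]; rewrite andbT.
by case: b E => /=; lia.
Qed.

Lemma partner_gate (p q : pos) : isgate m.*2 p -> partner p q -> isgate m.*2.+1 q.
Proof.
case: p => [|[[j b] i]] //= /andP[_ /eqP E] /eqP->; rewrite /= (@lpK j) // eqxx /=.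
by case: b E => /=; lia.
Qed.

Lemma evengateW (p : pos) : evengate m.+1 p -> evengate m p.
Proof. by case: p => [|[[j b] i]] //= /and3P[h -> ->]; rewrite ltnW. Qed.

Lemma slot_not_even k e (p : pos) : isslot e p -> evengate k p = false.
Proof. by case: p => [|[[j b] i]] //= /andP[h _]; rewrite ltn_eqF ?andbF. Qed.

Lemma path_vin u v w : path (@gstep m) v w -> path (@gstep m.+1) (vin u v) (map (vin u) w).
Proof.
elim: w v => //= b w IH v /andP[h p]; rewrite IH // andbT; move: h.
rewrite /gstep => /andP[h1 h2] /=; rewrite eqxx -!surjective_pairing h1 /=.
apply/implyP => /evengateW he; have /andP[/eqP-> ->] := implyP h2 he.
by rewrite eqxx.
Qed.

(** From an even gate of level [m], [gstep m] leads only to its twin. The detour fits in between: it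
    is entered at a [2m]-slot and left at a slot labelled [2m+1], which is joined to the twin. *)
Lemma path_splice v w : isslot m.*2 x'.2 -> isslot m.*2.+1 (last x' w').2 ->
  path (@gstep m) x' w' -> ~~ isg (last v w) -> path (@gstep m) v w ->
  exists t, [/\ splice (v :: w) = vout v :: t, path (@gstep m.+1) (vout v) t
    & last (vout v) t = vout (last v w)].
Proof.
move=> s0 s1 p'; elim: w v => [|v1 w IH] v /=.
  move=> g _; exists [::]; split=> //.
  by rewrite /splice /= /blk (negPf g).
move=> g /andP[h p]; have [t [E pt lt]] := IH _ g p.
rewrite -[splice _]/(blk v ++ splice (v1 :: w)) E /blk.
case gv: (isg v) => /=.
  exists (map (vin v.1) (x' :: w') ++ vout v1 :: t); split=> //; last first.
    by rewrite last_cat.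
  have /andP[h1 h2] := h; have /andP[/eqP v1E pr] := implyP h2 (gate_even gv).
  rewrite cat_path /= pt andbT path_vin // andbT (last_map (vin v.1)); apply/andP; split.
    rewrite /gstep /= eqxx (attI (e := m.*2)) ?doubleK //=.
    apply/implyP => /= he; exfalso; move: gv he; rewrite /isg.
    by case: (v.2) => [|[[j b] i]] //= /andP[_ /eqP E1] /and3P[h3]; case: (b) E1; lia.
  rewrite /gstep /= (slot_not_even _ s1) andbT v1E eqxx /=.
  by apply: (attI (e := m.*2.+1)) => //; [lia|apply: partner_gate pr].
exists (vout v1 :: t); split=> //=; rewrite pt andbT.
move: h; rewrite /gstep /= -!surjective_pairing => /andP[-> h2] /=.
apply/implyP => /evengateW he; have /andP[/eqP-> ->] := implyP h2 he.
by rewrite eqxx.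
Qed.

End Splice.

Fixpoint cnt m := if m is m'.+1 then cnt m' + cnt m' * cnt m' else 1.

(** All [k] are treated at once: the outer walk keeps its ends, and the inserted one takes [k = m].
    The visits to all gate labels from [2m] on are counted, since later levels splice there. *)
Lemma walk m k : m <= nlev -> k < nlev -> exists x w,
  [/\ isslot k.*2 (x.2 : pos), isslot k.*2.+1 (last x w).2, path (@gstep m) x w, uniq (x :: w)
    & forall e, m.*2 <= e < lam -> cnt m <= count (fun v => isgate e v.2) (x :: w)].
Proof.
elim: m k => [|m IH] k mn kn.
  have [x [h [h1 h2 h3 h4 h5]]] := upath kn.
  exists (tt, x), (map (pair tt) h); split=> //.
  - by rewrite (last_map (pair tt)).
  - rewrite path_map; apply: sub_path h3 => p q /andP[a b].
    by rewrite /gstep /= a.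
  - by rewrite -[_ :: _]/(map (pair tt) (x :: h)) map_inj_uniq // => a b [].
  - move=> e /andP[_ /h5]; rewrite has_count => hc.
    by rewrite -[_ :: map _ _]/(map (pair tt) (x :: h)) count_map.
have [x' [w' [a1 a2 a3 a4 a5]]] := IH m (ltnW mn) mn.
have [x [w [b1 b2 b3 b4 b5]]] := IH k (ltnW mn) kn.
have ng : ~~ isg (last x w) by apply/negP => /isgate_not_slot/negP; apply; exact: b2.
have [t [E pt lt]] := path_splice a1 a2 a3 ng b3.
exists (vout x), t; split=> //; rewrite ?lt // -?E.
- exact: uniq_splice.
- move=> e he; rewrite (count_splice x' w' (isgate e)).
  apply: leq_add; first by apply: b5; lia.
  apply: leq_mul; last by apply: a5; lia.
  by apply: b5; move: mn; rewrite /lam; lia.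
Qed.

Lemma cnt_ge m : 2 ^ 2 ^ m <= cnt m.+1.
Proof.
elim: m => // m IH; rewrite [cnt m.+2]/(cnt m.+1 + cnt m.+1 * cnt m.+1).
rewrite expnS mul2n -addnn expnD; apply: leq_trans (leq_addl _ _).
exact: leq_mul.
Qed.

Lemma gpath_exists : 1 < nlev -> exists w : seq (vtx nlev),
  [/\ uniq w, sorted (@gadj N nlev) w & 2 ^ 2 ^ nlev.-1 <= size w].
Proof.
move=> n1; have n0 : nlev.-1 < nlev by lia.
have [x' [w' [a1 a2 a3 a4 a5]]] := walk (ltnW n0) n0.
have ng : ~~ isg (last x' w') by apply/negP => /isgate_not_slot/negP; apply; exact: a2.
(* One last splice, now counting all vertices instead of the gates of one label. *)
have [t [E pt lt]] := path_splice a1 a2 a3 ng a3.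
have : uniq (splice x' w' (x' :: w')) by apply: uniq_splice.
have : sorted (@gstep nlev.-1.+1) (splice x' w' (x' :: w')) by rewrite E.
have : 2 ^ 2 ^ nlev.-1 <= size (splice x' w' (x' :: w')).
  have := count_splice x' w' predT (x' :: w').
  rewrite -[count (fun=> _) (splice _ _ _)]/(count predT _) -[count (fun v => _ v.2) _]/(count predT _) !count_predT => ->.
  apply: leq_trans (leq_addl _ _).
  have h : cnt nlev.-1 <= count (@isg nlev.-1) (x' :: w').
    by apply: a5; rewrite /lam; lia.
  have h' : cnt nlev.-1 <= size (x' :: w') by apply: leq_trans h (count_size _ _).
  apply: leq_trans (leq_mul h h').
  have -> : nlev.-1 = nlev.-2.+1 by lia.
  rewrite expnS mul2n -addnn expnD; apply: leq_mul; exact: cnt_ge.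
move: (splice _ _ _); rewrite (prednK (ltnW n1)) => w h1 h2 h3; exists w; split=> //.
by apply: sub_sorted h2 => y z /andP[].
Qed.

End LongPath.

(** * Degeneracy *)

Section Degeneracy.
Variable N : nat.
Local Notation nlev := (nlev N).
Local Notation pos := (pos N).
Local Notation maxlen := (maxlen N).
Local Notation len := (len N).
Local Notation vtx := (vtx N).

Definition anyslot (p : pos) := if p is inr (j, _, i) then i < len j else false.

Lemma isslot_any e p : isslot e p -> anyslot p.
Proof. by case: p => [|[[j b] i]] //= /andP[]. Qed.

Definition urank (p : pos) : nat :=
  match p with inl v => v | inr (_, b, i) => nlev.+1 + i.*2 + b end.

Definition uback (p : pos) : seq pos :=
  match p with
  | inl v => [:: inl (inord v.-1)]
  | inr (j, b, i) =>
    (if i == 0 :> nat then inl (inord (j + b)) else inr (j, b, inord i.-1)) ::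
    (if i < len j then [::] else [:: inr (j, false, i)])
  end.

(** A slot has at most one earlier neighbour in its unit, which leaves a place for the gate it may
    be attached to. *)
Lemma size_uback p : size (uback p) + anyslot p <= 2.
Proof. by case: p => [v|[[j b] i]] //=; case: ifP. Qed.

Lemma mem_uback p q : uadj p q -> urank q <= urank p -> q \in uback p.
Proof.
case: p => [v|[[j b] i]]; case: q => [w|[[j' b'] i']] /=.
- move=> vw wv; rewrite inE; apply/eqP; congr inl; apply: val_inj.
  by move: vw wv; rewrite /nat_step /= inordK; have := ltn_ord v; have := ltn_ord w; lia.
- by move=> _; have := ltn_ord v; lia.
- case/andP=> -> /eqP E _; rewrite inE; apply/orP; left; apply/eqP; congr inl.
  by apply: val_inj; rewrite /= inordK -?E.
case/andP=> /eqP<-; case: eqP => [<-|bb].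
  case/and3P=> st h1 h2 r; have E : i = i'.+1 :> nat by move: st r; rewrite /nat_step; lia.
  rewrite E /= inE; apply/orP; left; apply/eqP; congr (inr (_, _)); apply: val_inj.
  by rewrite /= inordK.
case/andP=> /eqP h1 /eqP h2 r; rewrite ifN ?inE; last by rewrite h1 -lt0n len_gt0.
rewrite h1 ltnn inE; apply/orP; right; apply/eqP.
have -> : i' = i by apply: val_inj; rewrite /= h1 h2.
by case: b b' bb r => [] [] //=; rewrite h1 h2; lia.
Qed.

(** The offset puts the attached copies after all units of the previous graph, whose depths are
    below [2^m']. *)
Fixpoint dep m : node m -> nat :=
  match m return node m -> nat with
  | 0 => fun _ => 0
  | m'.+1 => fun t => match t with inl u => dep u | inr (_, w) => 2 ^ m' + dep w end
  end.

Lemma dep_lt m (t : node m) : dep t < 2 ^ m.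
Proof.
elim: m t => [|m IH] //= [u|[u w]]; rewrite expnS; first by have := IH u; lia.
by have := IH w; lia.
Qed.

(** Edges to other units of no greater depth lead from a slot to the gate of its label. They arise
    only at the level of that label, and the unit there has just one such gate. *)
Lemma gback m (x : vtx m) : exists s : seq (vtx m), size s <= anyslot x.2 /\
  forall y, gadj x y -> x.1 != y.1 -> dep y.1 <= dep x.1 -> y \in s.
Proof.
elim: m x => [|m IH] [t p].
  by exists [::]; split=> // -[t' q] _; case: (t) (t') => [] [].
case: t => [u|[u w]].
  have [s [s1 s2]] := IH (u, p).
  exists (map (fun v : vtx m => (inl v.1, v.2) : vtx m.+1) s); rewrite size_map; split=> //.
  case=> [[u'|[u' w']] q] /= a n d; last by have := dep_lt u; lia.
  by apply/mapP; exists (u', q) => //; apply: s2.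
case/boolP: [exists q, att m q p] => [/existsP[q aq]|/existsPn no].
  exists [:: (inl u, q) : vtx m.+1]; have [e [E g sl]] := attP aq.
  split; first by rewrite (isslot_any sl).
  case=> [[u'|[u' w']] q'] /=.
    case/andP=> /eqP-> /attP[e' [_ g' sl']] _ _; rewrite inE.
    move: g'; rewrite -(isslot_mu sl') (isslot_mu sl) => g'.
    by rewrite (gate_inj g g') eqxx.
  case/andP=> /eqP-> /gadjE[[/= -> _]|[e' l []]]; first by rewrite eqxx.
    by case=> /(isgate_not_slot e) /=; rewrite sl.
  by case=> /isslot_mu /= E'; move: l; rewrite -E' (isslot_mu sl) E ltnn.
have [s [s1 s2]] := IH (w, p).
exists (map (fun v : vtx m => (inr (u, v.1), v.2) : vtx m.+1) s); rewrite size_map; split=> //.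
case=> [[u'|[u' w']] q] /=; first by case/andP=> _ aq; have := no q; rewrite aq.
case/andP=> /eqP<- a n d; apply/mapP; exists (w', q) => //; apply: s2 => //=.
  by apply: contraNneq n => ->.
by lia.
Qed.

Definition rank m (x : vtx m) := dep x.1 * (nlev.+1 + maxlen.*2.+2) + urank x.2.

Lemma urank_lt p : urank p < nlev.+1 + maxlen.*2.+2.
Proof.
case: p => [v|[[j b] i]] /=; first by have := ltn_ord v; lia.
by have := ltn_ord i; case: b; lia.
Qed.

Lemma back_edges m (x : vtx m) : exists s : seq (vtx m), size s <= 2 /\
  forall y, gadj x y -> rank y <= rank x -> y \in s.
Proof.
have [s [s1 s2]] := gback x.
exists (map (pair x.1) (uback x.2) ++ s); split.
  by rewrite size_cat size_map; have := size_uback x.2; lia.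
move=> y xy; rewrite /rank mem_cat => r; case: (eqVneq x.1 y.1) => [E|ne].
  apply/orP; left; apply/mapP; exists y.2; last by rewrite E -surjective_pairing.
  apply: mem_uback; last by move: r; rewrite E; lia.
  by move: xy; rewrite [x]surjective_pairing [y]surjective_pairing E gadj_unit.
apply/orP; right; apply: s2 => //; rewrite leqNgt; apply/negP => d.
move: r; apply/negP; rewrite -ltnNge; have := urank_lt x.2; move: d; set M := _ + _.
by move=> d h; apply: leq_trans (leq_addr _ _); have := leq_mul d (leqnn M); rewrite mulSn; lia.
Qed.

Definition ggraph m := SGraph (@gadj_sym N m) (@gadj_irr N m).

(** A vertex of largest rank in the subgraph has no later neighbour there, hence at most two
    neighbours. *)
Lemma ggraph_degenerate m : degenerate 2 (ggraph m).
Proof.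
move=> H [x0 hx0].
case: (@arg_maxnP _ x0 (mem (sub_vertex H)) (@rank m) hx0) => x hx mx.
have [s [s1 s2]] := back_edges x; exists x => //.
rewrite /sub_degree cardE; apply: leq_trans (uniq_leq_size (enum_uniq _) _) s1 => y.
by rewrite mem_enum inE => /sub_adjP[a _ hy]; apply: s2 => //; apply: mx.
Qed.

End Degeneracy.

(** * From the combinatorial bounds to logarithms and the theorem *)

Lemma ipath_of_induced (G : sgraph) (p : seq G) : is_induced_path p -> ipath (@adj G) p.
Proof.
case=> [[up so] ch]; split=> // s1 x s2 y s3 E xy.
have xp : x \in p by rewrite E mem_cat mem_head orbT.
have yp : y \in p by rewrite E mem_cat inE mem_cat mem_head !orbT.
have E' : p = (s1 ++ x :: s2) ++ y :: s3 by rewrite -catA.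
have ix : index x p = size s1.
  move: up; rewrite E cat_uniq => /and3P[_ /norP[xs _] _].
  by rewrite index_cat (negPf xs) /= eqxx addn0.
have iy : index y p = size s1 + (size s2).+1.
  move: up; rewrite E' cat_uniq => /and3P[_ /norP[ys _] _].
  by rewrite index_cat (negPf ys) /= eqxx addn0 size_cat.
by have := ch x y xp yp xy; rewrite ix iy => h; apply: size0nil; case: h; lia.
Qed.

Lemma ibound_le N : ibound N <= 80 * 100 * (N.+2 * 2 ^ N).
Proof.
have := maxlen_le N; have l1 : 0 < 2 ^ N by rewrite expn_gt0.
have E : Lg N * lam N = 66 * (N.+2 * 2 ^ N) by rewrite lamE /Lg expnS; lia.
have h1 : lam N <= N.+2 * 2 ^ N by rewrite lamE expnS; nia.
have h2 : nlev N <= N.+2 * 2 ^ N by rewrite /nlev; nia.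
have h3 : 0 < N.+2 * 2 ^ N by nia.
rewrite /ibound /tau /kap mulnDl -[36 * _ * _]mulnA E.
move: (maxlen N) (nlev N) (lam N) (N.+2 * 2 ^ N) h1 h2 h3 {E l1} => a b c X.
by lia.
Qed.

Section Log.
Variable R : realType.
Local Open Scope ring_scope.

Lemma log2_le (x y : R) : 0 < x -> x <= y -> log2 x <= log2 y.
Proof.
move=> x0 xy; have y0 := lt_le_trans x0 xy.
by rewrite /log2 ler_pM2r ?invr_gt0 ?ln_gt0 ?ltr1n // ler_ln.
Qed.

Lemma log2X k : log2 (2 ^+ k) = k%:R :> R.
Proof.
rewrite /log2 lnXn // mulrnAl divff // gt_eqF // ln_gt0 // ltr1n //.
Qed.

Lemma log2_ge (x : R) k : (2 ^ k)%:R <= x -> k%:R <= log2 x.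
Proof.
move=> h; rewrite -log2X -natrX; apply: log2_le => //.
by rewrite ltr0n expn_gt0.
Qed.

(** The double logarithm of [n] is at least [2^N - 1 >= 2^(N-1)], and the triple one at least
    [N - 1]. *)
Lemma bound_log N n : (1 < N)%N -> (2 ^ 2 ^ (2 ^ N).-1 <= n)%N ->
  (N.+2 * 2 ^ N)%:R <= 8 * log2 (log2 n%:R) * log2 (log2 (log2 n%:R)) :> R.
Proof.
move=> N1 hn.
have l1 : (2 ^ (2 ^ N).-1)%:R <= log2 n%:R :> R by apply: log2_ge; rewrite ler_nat.
have l2 : (2 ^ N).-1%:R <= log2 (log2 n%:R) :> R by apply: log2_ge.
have EN : (2 ^ N = 2 * 2 ^ N.-1)%N by rewrite -expnS prednK // ltnW.
have h : (2 ^ N.-1 <= (2 ^ N).-1)%N.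
  by rewrite EN; have /= := expn_gt0 2 N.-1; lia.
have l2' : (2 ^ N.-1)%:R <= log2 (log2 n%:R) :> R by apply: le_trans l2; rewrite ler_nat.
have l3 : N.-1%:R <= log2 (log2 (log2 n%:R)) :> R by apply: log2_ge.
have : (2 ^ N.-1)%:R * N.-1%:R <= log2 (log2 n%:R) * log2 (log2 (log2 n%:R)) :> R.
  by apply: ler_pM.
move=> L; apply: (@le_trans _ _ (8 * ((2 ^ N.-1)%:R * N.-1%:R))); last by rewrite -mulrA ler_pM2l.
(* The factor 8: [2^N] is twice [2^(N-1)], and [N + 2 <= 4 (N - 1)] as [N >= 2]. *)
rewrite -!natrM ler_nat EN.
have : (N.+2 <= 4 * N.-1)%N by lia.
by move: (2 ^ _)%N => X; nia.
Qed.

End Log.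

Local Open Scope classical_set_scope.
Local Open Scope ring_scope.

Theorem theorem1p4 (R : realType) :
  exists c : R,
    infinite_set [set n : nat |
      exists G : sgraph,
        [/\ degenerate 2 G,
            exists p : seq G, is_path p /\ size p = n
          & forall p : seq G, is_induced_path p ->
              (size p)%:R <= c * log2 (log2 n%:R) * log2 (log2 (log2 n%:R))]].
Proof.
exists ((80 * 100)%N%:R * 8) => /finite_seqP[s Es].
(* The path [w] will have at least [N] vertices, more than any member of the supposedly finite set,
   to which [size w] nevertheless belongs. The offset 2 also ensures [1 < N]. *)
pose N := (\max_(n <- s) n).+2.
have [|w [uw sw nw]] := @gpath_exists N.
  by rewrite /nlev expnS; have := expn_gt0 2 N.-1; lia.
have : size w \in s.
  suff : [set` s] (size w) by [].
  rewrite -Es /=; exists (ggraph N (nlev N)); split; first exact: ggraph_degenerate.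
    by exists w.
  move=> p /ipath_of_induced/ipath_bound hp.
  have := @bound_log R N (size w) isT nw.
  move: (log2 (log2 _)) (log2 (log2 (log2 _))) => a b L.
  rewrite -!mulrA; apply: (@le_trans _ _ (80 * 100 * (N.+2 * 2 ^ N))%N%:R).
    by rewrite ler_nat; apply: leq_trans hp (ibound_le N).
  by rewrite [(80 * 100 * _)%:R]natrM ler_pM2l ?ltr0n // mulrA.
move=> /(@leq_bigmax_seq _ _ predT id); rewrite -ltnS => /(_ isT).
apply/negP; rewrite -leqNgt.
suff : (N <= size w)%N by apply: leq_trans.
have lt2 k : (k < 2 ^ k)%N by exact: ltn_expl.
apply: leq_trans nw; have := lt2 N; rewrite -/(nlev N).
by have := lt2 (nlev N).-1; have := lt2 (2 ^ (nlev N).-1)%N; lia.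
Qed.
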